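(* For any $\rho_1,\rho_2\in[0,1/2]$ satisfying $$(1-2\rho_1)^2+(1-2\rho_2)^2>1$$ there exist an $\epsilon>0$ and $n_0$ such that for any $n\ge n_0$, any $S\subset\mathbb{F}_2^n$ with $|S|\le e^{nh(\rho_1)}$ and $\Sigma=B_{\rho_2n}$ we have $$\cos\angle(V_S,\hat V_\Sigma)\le e^{-n\epsilon}.$$ Conversely, for $\rho_1,\rho_2\in[0,1/2]$ satisfying $$(1-2\rho_1)^2+(1-2\rho_2)^2<1$$ there exist $\epsilon>0$ and $n_0$ such that for all $n\ge n_0$ we have $$\cos\angle(V_S,\hat V_\Sigma)\ge1-e^{-n\epsilon},\qquad S=B_{\rho_1n},\ \Sigma=B_{\rho_2n}.$$
   Context: $h(x)=-x\ln x-(1-x)\ln(1-x)$ (natural logarithm, $0\ln 0=0$). For $x\in\mathbb{F}_2^n$, $|x|$ is the Hamming weight and $B_r=\{x\in\mathbb{F}_2^n:|x|\le r\}$. For $f:\mathbb{F}_2^n\to\mathbb{C}$ the Fourier transform is $\hat f(\omega)=\sum_{x\in\mathbb{F}_2^n}(-1)^{\langle\omega,x\rangle}f(x)$, $\omega\in\mathbb{F}_2^n$, with $\langle\omega,x\rangle=\sum_j\omega_jx_j$. For $S,\Sigma\subset\mathbb{F}_2^n$ define the subspaces of functions on $\mathbb{F}_2^n$: $V_S=\{f:\mathrm{supp}\,f\subset S\}$ and $\hat V_\Sigma=\{f:\mathrm{supp}\,\hat f\subset\Sigma\}$. For subspaces $V_1,V_2$ of a Hilbert space, $\cos\angle(V_1,V_2)=\sup\frac{|(f_1,f_2)|}{\|f_1\|_2\|f_2\|_2}$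 over nonzero $f_1\in V_1,f_2\in V_2$; here the inner product is the $L_2$ inner product with respect to the uniform probability measure on $\mathbb{F}_2^n$ (its normalization does not matter). *)

(* Defs.v *)
From HB Require Import structures.
From mathcomp Require Export all_boot all_order all_algebra.
From mathcomp Require Export all_classical all_reals all_analysis.
From mathcomp Require Export complex.

Set Implicit Arguments.
Unset Strict Implicit.
Unset Printing Implicit Defensive.

Import Order.TTheory GRing.Theory Num.Theory.

Local Open Scope ring_scope.

(* [ln 0 = 0] in the library, so the convention [0 ln 0 = 0] holds. *)
Definition entropy (R : realType) (x : R) : R :=
  - x * ln x - (1 - x) * ln (1 - x).

Notation cube n := 'rV['F_2]_n.

Definition weight (n : nat) (x : cube n) : nat :=
  #|[pred j : 'I_n | x ord0 j != 0]|.

(* The radius [r] is real, e.g. [r = n * rho]. *)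
Definition hball (R : realType) (n : nat) (r : R) : {set cube n} :=
  [set x : cube n | (weight x)%:R <= r]%SET.
Arguments hball {R} n r.

Definition pairing (n : nat) (w x : cube n) : 'F_2 :=
  \sum_(j < n) w ord0 j * x ord0 j.

Notation cfun R n := {ffun cube n -> R[i]}.

Definition fourier (R : realType) (n : nat) (f : cfun R n) : cfun R n :=
  [ffun w => \sum_(x : cube n) (-1) ^+ val (pairing w x) * f x].

Definition V_time (R : realType) (n : nat) (S : {set cube n}) :
    set (cfun R n) :=
  [set f : cfun R n | 0.-support f \subset S]%classic.
Arguments V_time R {n} S.

Definition V_freq (R : realType) (n : nat) (Sigma : {set cube n}) :
    set (cfun R n) :=
  [set f : cfun R n | 0.-support (fourier f) \subset Sigma]%classic.
Arguments V_freq R {n} Sigma.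

(* The L2 inner product for the uniform probability measure on [cube n]. *)
Definition inner (R : realType) (n : nat) (f g : cfun R n) : R[i] :=
  #|{: cube n}|%:R^-1 * \sum_(x : cube n) f x * conjc (g x).

(* [inner f f] is a nonnegative real number, seen as a complex one. *)
Definition norm2 (R : realType) (n : nat) (f : cfun R n) : R :=
  Num.sqrt (complex.Re (inner f f)).

(* By Cauchy-Schwarz, the quotients are bounded by 1, so that [sup] is the
   actual supremum as soon as both subspaces are nonzero. If one of them is
   zero, then [sup] is taken over the empty set and its value is 0. *)
Definition cos_angle (R : realType) (n : nat) (V1 V2 : set (cfun R n)) : R :=
  sup [set c : R | exists f1 f2 : cfun R n,
    [/\ V1 f1, V2 f2, f1 != 0, f2 != 0 &
        c = complex.Re `|inner f1 f2| / (norm2 f1 * norm2 f2)]]%classic.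

(* Main.v *)
Require Import Defs.
From mathcomp Require Import zify ring lra.

(** Both halves compare [2 * Num.sqrt (rho1 * (1 - rho1))] with
    [1 - 2 * rho2]: squaring shows that the sign of
    [(1 - 2 * rho1) ^+ 2 + (1 - 2 * rho2) ^+ 2 - 1] decides which is larger.
    The first number, times [n], is asymptotically the largest eigenvalue that
    the adjacency matrix of the cube can have on functions living on
    [expR (n * entropy rho1)] points; the second, times [n], is the least
    eigenvalue occurring among the characters of weight at most [rho2 * n].

    Upper bound. By Parseval and Cauchy-Schwarz, the cosine is at most [d] as
    soon as every [f] supported on [S] has at most the fraction [d ^+ 2] of its
    spectral mass on the ball ([cos_angle_le]).  On the ball the multiplier
    [(1 - 2 * q) ^+ weight w] is at least about
    [expR (- 2 * q * rho2 * n)], so it is enough to bound the quadratic form of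
    the noise operator with flipping probability [q].  For [p] slightly
    smaller than 2, namely [2 / p = 1 + c * q], this form is at most
    [K ^+ n] times the squared p-norm of [f]: the inequality tensorizes
    ([noise_norm_bound]), and [K] comes from a single bit ([bit_norm_bound]).
    The power mean inequality on [S] then replaces the squared p-norm by
    [#|S| `^ (c * q)] times the squared 2-norm.  To first order in [q] the
    logarithm of the resulting constant, divided by [n * q], is
      max over y of (2 * Num.sqrt (y * (1 - y)) - c * entropy y)
        - 1 + c * entropy rho1 + 2 * rho2.
    Since [Num.sqrt (y * (1 - y))] is a concave function of [entropy y], some
    [c] puts the maximum at [y = rho1] ([sqrt_le_entropy_tangent]); the
    entropies cancel and [2 * Num.sqrt (rho1 * (1 - rho1)) - (1 - 2 * rho2)]
    is left, which is negative.  A small fixed [q] absorbs the second order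
    terms.

    Lower bound. A function spread evenly over a bounded number of levels just
    below [rho1 * n] nearly attains the eigenvalue above ([rayleigh_test]).
    Applying [n] times the identity plus the adjacency matrix, [k] times over,
    enlarges the support by only [k], and multiplies the spectrum by the [k]-th
    power of [2 * (n - weight w)].  For [k] proportional to [n] the
    frequencies of weight above [rho2 * n] thus become exponentially small
    relative to the whole ([leakage_iter_smooth]), and truncating the spectrum
    gives the second function ([cos_angle_ge]). *)

Set Implicit Arguments.
Unset Strict Implicit.
Unset Printing Implicit Defensive.

Import Order.TTheory GRing.Theory Num.Theory.
Import numFieldNormedType.Exports.
Local Open Scope ring_scope.
Local Open Scope complex_scope.

(** * Comparing the square root with the entropy *)

Lemma ler0_is_derive (R : realType) (f df : R -> R) (a b : R) :
  a <= b -> (forall x, a <= x <= b -> is_derive x 1 f (df x)) ->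
  (forall x, a < x < b -> df x <= 0) -> f b <= f a.
Proof.
move=> ab fdf df0.
have fd x : a <= x <= b -> derivable f x 1.
  by move=> /fdf h; apply: ex_derive.
apply: (@ler0_derive1_le_cc _ f a b _ _ _ b a) => //.
- move=> x; rewrite in_itv /= => /andP[ax xb]; apply: fd.
  by rewrite !ltW.
- move=> x; rewrite in_itv /= => /andP[ax xb].
  have h : is_derive x 1 f (df x) by apply: fdf; rewrite !ltW.
  by rewrite derive1E derive_val df0 // ax xb.
- apply: derivable_within_continuous => x; rewrite in_itv /=; exact: fd.
- by rewrite in_itv /= lexx ab.
- by rewrite in_itv /= lexx ab.
Qed.

(** Convexity of sinh on the nonnegative half-line, between 0 and [v]. *)
Lemma sinh_scale (R : realType) (l v : R) : 0 <= l <= 1 -> 0 <= v ->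
  expR (l * v) - expR (- (l * v)) <= l * (expR v - expR (- v)).
Proof.
move=> /andP[l0 l1] v0.
pose f := fun v : R =>
  expR (l * v) - expR (- (l * v)) - l * (expR v - expR (- v)).
pose df := fun v : R =>
  l * (expR (l * v) + expR (- (l * v)) - (expR v + expR (- v))).
suff : f v <= f 0 by rewrite /f !mulr0 !oppr0 !subrr; lra.
apply: (@ler0_is_derive R f df) => // x.
  move=> _; rewrite /f /df; apply: is_derive_eq.
  rewrite /GRing.scale /=. ring.
move=> /andP[x0 _]; rewrite /df.
have lx : l * x <= x by rewrite ler_piMl // ltW.
have lx0 : 0 <= l * x by rewrite mulr_ge0 // ltW.
have e1 : 1 <= expR (l * x) by rewrite -expR0 ler_expR.
have e2 : expR (l * x) <= expR x by rewrite ler_expR.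
rewrite !expRN.
set a := expR (l * x) in e1 e2 *; set b := expR x in e2 *.
have -> : l * (a + a^-1 - (b + b^-1)) = - (l * (b - a) * (1 - a^-1 * b^-1)).
  by field; apply/andP; split; lra.
rewrite oppr_le0 mulr_ge0 ?mulr_ge0 ?subr_ge0 //.
by rewrite -invfM invf_le1; nra.
Qed.

Lemma mul_sinh_le (R : realType) (a b : R) : 0 <= a <= b ->
  b * (expR a - expR (- a)) <= a * (expR b - expR (- b)).
Proof.
move=> /andP[a0 ab].
have [b0|b0] := eqVneq b 0; first by have -> : a = b by lra; rewrite b0 !mul0r.
have bp : 0 < b by rewrite lt_neqAle eq_sym b0 (le_trans a0).
have h : 0 <= a / b <= 1.
  by rewrite divr_ge0 ?(ltW bp) // ler_pdivrMr ?mul1r.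
have := @sinh_scale R (a / b) b h (ltW bp).
rewrite divfK // -(@ler_pM2l _ b) // => /le_trans; apply.
by rewrite mulrA [b * _]mulrC divfK.
Qed.

(** In the variable [ln t], this says that sinh(u) / u is increasing. *)
Lemma subV_mul_ln_le (R : realType) (s t : R) : 1 <= s <= t ->
  (s - s^-1) * ln t <= (t - t^-1) * ln s.
Proof.
move=> /andP[s1 st].
have s0 : 0 < s by lra.
have t0 : 0 < t by lra.
have := @mul_sinh_le R (ln s) (ln t).
rewrite !expRN !lnK ?posrE // => h.
rewrite mulrC [leRHS]mulrC; apply: h.
by rewrite ln_ge0 //= ler_ln ?posrE.
Qed.

Lemma entropyC (R : realType) (y : R) : entropy (1 - y) = entropy y.
Proof. by rewrite /entropy subKr; ring. Qed.

Lemma entropy0 (R : realType) : entropy 0 = 0 :> R.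
Proof. by rewrite /entropy ?(oppr0, mul0r, addr0, ln1, mulr0). Qed.

(** Derivative of [2 * Num.sqrt (y * (1 - y))]. *)
Definition slope_sqrt (R : realType) (y : R) : R :=
  (1 - 2 * y) / Num.sqrt (y * (1 - y)).

(** Derivative of [entropy]. *)
Definition slope_entropy (R : realType) (y : R) : R := ln (1 - y) - ln y.

Lemma is_derive_sqrt_entropy (R : realType) (c y : R) : 0 < y < 1 ->
  is_derive y 1 (fun y => 2 * Num.sqrt (y * (1 - y)) - c * entropy y)
    (slope_sqrt y - c * slope_entropy y).
Proof.
rewrite /slope_sqrt /slope_entropy.
move=> /andP[y0 y1].
have z0 : 0 < 1 - y by lra.
have p0 : 0 < y * (1 - y) by rewrite mulr_gt0.
have s0 : Num.sqrt (y * (1 - y)) != 0 by rewrite sqrtr_eq0 -ltNge.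
have d1 : is_derive y 1 (fun y : R => Num.sqrt (y * (1 - y))) 
   ((2 * Num.sqrt (y * (1 - y)))^-1 * (1 - 2 * y)).
  have := @is_derive1_comp _ Num.sqrt (fun y : R => y * (1 - y)) y _ (1 - 2 * y)
    (is_derive1_sqrt p0).
  apply. apply: is_derive_eq. rewrite /GRing.scale /=. ring.
have d2 : is_derive y 1 (fun y : R => ln y) y^-1 by exact: is_derive1_ln.
have d3 : is_derive y 1 (fun y : R => ln (1 - y)) (- (1 - y)^-1).
  have := @is_derive1_comp _ (@ln R) (fun y : R => 1 - y) y _ (-1) (is_derive1_ln z0).
  rewrite mulrN1; apply. apply: is_derive_eq. ring.
rewrite /entropy.
apply: is_derive_eq.
rewrite /GRing.scale /=. field. by rewrite s0 /=; apply/andP; split; lra.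
Qed.

Lemma ln_le_subr1 (R : realType) (x : R) : 0 < x -> ln x <= x - 1.
Proof. by move=> x0; rewrite -{1}(subrKC 1 x) le_ln1Dx //; lra. Qed.

Lemma oppr_ln_le (R : realType) (x : R) : 0 < x -> - ln x <= x^-1 - 1.
Proof. by move=> x0; rewrite -lnV ?posrE // ln_le_subr1 ?invr_gt0. Qed.

(** A quantitative form of the vanishing of y ln y at 0, strong enough to bound
    both [entropy y] and y (ln y)^2. *)
Lemma sqrt_mul_ln_bound (R : realType) (y : R) : 0 <= y <= 1 ->
  0 <= - (Num.sqrt y * ln y) <= 2.
Proof.
move=> /andP[y0 y1].
have [->|yn0] := eqVneq y 0; first by rewrite sqrtr0 mul0r oppr0 lexx /=.
have yp : 0 < y by rewrite lt_neqAle eq_sym yn0.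
have sp : 0 < Num.sqrt y by rewrite sqrtr_gt0.
set s := Num.sqrt y in sp *.
have ys : y = s * s by rewrite -expr2 sqr_sqrtr.
have lny : ln y = ln s + ln s by rewrite ys lnM ?posrE.
have := ln_le0 y1; have := @oppr_ln_le _ s sp.
rewrite lny => h1 h2.
have : s * (- ln s) <= s * (s^-1 - 1) by rewrite ler_pM2l.
rewrite mulrBr divff ?gt_eqF // => h3.
have h4 : 0 <= s * - ln s by rewrite mulr_ge0; lra.
by apply/andP; split; lra.
Qed.

Lemma entropy_ge0 (R : realType) (y : R) : 0 <= y <= 1 -> 0 <= entropy y.
Proof.
move=> /andP[y0 y1]; rewrite /entropy !mulNr.
have a : 0 <= y * - ln y by rewrite mulr_ge0 // oppr_ge0 ln_le0.
have b : 0 <= (1 - y) * - ln (1 - y).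
  by rewrite mulr_ge0 ?oppr_ge0 ?ln_le0 ?subr_ge0 // gerBl.
by rewrite mulrN in a; rewrite mulrN in b; lra.
Qed.

Lemma oppr_mul_ln_le (R : realType) (y : R) : 0 <= y -> - (y * ln y) <= 1 - y.
Proof.
rewrite le_eqVlt => /predU1P[<-|y0]; first by rewrite mul0r oppr0 addr0.
have := @oppr_ln_le _ y y0.
rewrite -(ler_pM2l y0) mulrBr divff ?gt_eqF //; lra.
Qed.

Lemma entropy_le1 (R : realType) (y : R) : 0 <= y <= 1 -> entropy y <= 1.
Proof.
move=> /andP[y0 y1]; rewrite /entropy !mulNr.
have := @oppr_mul_ln_le _ y y0.
by have := @oppr_mul_ln_le _ (1 - y) _; rewrite subr_ge0 => /(_ y1); lra.
Qed.

Lemma entropy_le_sqrt (R : realType) (y : R) : 0 <= y <= 1 ->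
  entropy y <= 3 * Num.sqrt y.
Proof.
move=> /[dup] y01 /andP[y0 y1]; rewrite /entropy !mulNr.
have := @oppr_mul_ln_le _ (1 - y) _; rewrite subr_ge0 => /(_ y1) h1.
have /andP[_ h2] := @sqrt_mul_ln_bound _ y y01.
have sp : 0 <= Num.sqrt y := sqrtr_ge0 y.
have yE : y = Num.sqrt y * Num.sqrt y by rewrite -expr2 sqr_sqrtr.
have s1 : Num.sqrt y <= 1 by rewrite -sqrtr1 ler_sqrt.
have : Num.sqrt y * - (Num.sqrt y * ln y) <= Num.sqrt y * 2 by rewrite ler_wpM2l.
rewrite mulrN mulrA -yE => h3.
have : y <= Num.sqrt y by rewrite {1}yE ler_piMr.
lra.
Qed.

Lemma slope_entropy_gt0 (R : realType) (y : R) : 0 < y < 1/2 ->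
  0 < slope_entropy y.
Proof.
by move=> /andP[y0 y1]; rewrite subr_gt0 ltr_ln ?posrE; lra.
Qed.

(** The ratio of the two slopes is decreasing, that is,
    [Num.sqrt (y * (1 - y))] is a concave function of [entropy y]: with
    [t = Num.sqrt ((1 - y) / y)] the slopes are [t - t^-1] and [2 * ln t]. *)
Lemma slopeM_le (R : realType) (x y : R) : 0 < x <= y -> y <= 1 / 2 ->
  slope_sqrt y * slope_entropy x <= slope_sqrt x * slope_entropy y.
Proof.
move=> /andP[x0 xy] y12.
have slopesE (z : R) : 0 < z <= 1 / 2 ->
    let t := Num.sqrt (1 - z) / Num.sqrt z in
    [/\ slope_sqrt z = t - t^-1, slope_entropy z = ln t + ln t,
        0 < t & t ^+ 2 = (1 - z) / z].
  move=> /andP[z0 z1] t.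
  have z2 : 0 < 1 - z by lra.
  have sz : 0 < Num.sqrt z by rewrite sqrtr_gt0.
  have sz' : 0 < Num.sqrt (1 - z) by rewrite sqrtr_gt0.
  have tp : 0 < t by rewrite divr_gt0.
  have tt : t * t = (1 - z) / z.
    by rewrite /t mulrACA -invfM -!expr2 !sqr_sqrtr ?ltW.
  split => //.
  - rewrite /slope_sqrt sqrtrM ?ltW //.
    have -> : 1 - 2 * z = Num.sqrt (1 - z) ^+ 2 - Num.sqrt z ^+ 2.
      by rewrite !sqr_sqrtr ?ltW //; ring.
    by rewrite /t; field; rewrite !gt_eqF.
  - by rewrite -lnM ?posrE // tt lnM ?posrE ?invr_gt0 // lnV.
have [|-> -> tx0 tx2] := slopesE x; first by apply/andP; lra.
have [|-> -> ty0 ty2] := slopesE y; first by apply/andP; lra.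
set s := _ / Num.sqrt y in ty0 ty2 *; set t := _ / _ in tx0 tx2 *.
suff : (s - s^-1) * ln t <= (t - t^-1) * ln s by lra.
apply: subV_mul_ln_le; apply/andP; split.
  rewrite -(@ler_sqr _ 1) ?nnegrE ?(ltW ty0) // expr1n ty2 ler_pdivlMr; lra.
rewrite -ler_sqr ?nnegrE ?(ltW ty0) ?(ltW tx0) // ty2 tx2.
have -> : (1 - y) / y = y^-1 - 1 by field; lra.
have -> : (1 - x) / x = x^-1 - 1 by field; lra.
by rewrite lerD2r lef_pV2 ?posrE //; lra.
Qed.

(** The tangent at [rho] to the concave curve ([entropy], twice the square
    root); [c] is its slope.  The derivative in [y] of the left-hand side
    changes sign only at [rho] on the open interval from 0 to 1/2, and the
    symmetry [y -> 1 - y] covers the other half. *)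
Lemma sqrt_le_entropy_tangent (R : realType) (rho : R) : 0 < rho < 1 / 2 ->
  exists2 c : R, 0 < c & forall y : R, 0 <= y <= 1 ->
    2 * Num.sqrt (y * (1 - y)) - c * entropy y
    <= 2 * Num.sqrt (rho * (1 - rho)) - c * entropy rho.
Proof.
move=> /[dup] rho012 /andP[r0 r12].
have Lr : 0 < slope_entropy rho by rewrite slope_entropy_gt0.
pose c : R := slope_sqrt rho / slope_entropy rho.
have c0 : 0 < c.
  by rewrite !divr_gt0 ?sqrtr_gt0 ?mulr_gt0 //; lra.
exists c => //.
pose G : R -> R := fun y => 2 * Num.sqrt (y * (1 - y)) - c * entropy y.
pose dG : R -> R := fun y => slope_sqrt y - c * slope_entropy y.
have GdG (y : R) : 0 < y < 1 -> is_derive y 1 G (dG y).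
  by move=> y01; exact: is_derive_sqrt_entropy.
have half (y : R) : 0 < y <= 1 / 2 -> G y <= G rho.
  move=> /andP[y0 y1]; have [yr|ry] := leP y rho.
    have := @ler0_is_derive R (fun y => - G y) (fun y => - dG y) y rho yr.
    rewrite lerN2; apply=> x /andP[x1 x2].
      by apply: is_deriveN; apply: GdG; lra.
    rewrite /dG opprB subr_le0 /c mulrAC ler_pdivrMr //.
    by apply: slopeM_le; lra.
  apply: (@ler0_is_derive R G dG rho y (ltW ry)) => x /andP[x1 x2].
    by apply: GdG; lra.
  rewrite /dG subr_le0 /c mulrAC ler_pdivlMr //.
  by apply: slopeM_le; lra.
(* The endpoints escape the derivative argument. There [G] vanishes, so what
   is needed is [0 <= G rho]; it follows from [G y <= G rho] as [y] tends to
   0, because [entropy y] is at most [3 * Num.sqrt y]. *)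
have G0 : 0 <= G rho.
  rewrite leNgt; apply/negP => neg.
  pose s := Num.min (1 / 2) (- G rho / (4 * c)).
  have s0 : 0 < s by rewrite lt_min; apply/andP; split; [|apply: divr_gt0]; lra.
  have s1 : s <= 1 / 2 by rewrite ge_min lexx.
  have s2 : s * (4 * c) <= - G rho.
    by rewrite -ler_pdivlMr ?ge_min ?lexx ?orbT //; lra.
  have y01 : 0 < s ^+ 2 <= 1 / 2 by apply/andP; nra.
  have := half _ y01; rewrite {1}/G.
  have /(_ _)/= := @entropy_le_sqrt R (s ^+ 2).
  rewrite sqrtr_sqr gtr0_norm // => h.
  have {}h : entropy (s ^+ 2) <= 3 * s by apply: h; lra.
  have := sqrtr_ge0 (s ^+ 2 * (1 - s ^+ 2)).
  have : c * entropy (s ^+ 2) <= c * (3 * s) by rewrite ler_pM2l.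
  have : 0 < c * s by rewrite mulr_gt0.
  lra.
have GC (y : R) : G (1 - y) = G y by rewrite /G entropyC subKr [(1 - y) * y]mulrC.
move=> y /andP[y0 y1]; rewrite -/(G y) -/(G rho).
have [->|yn0] := eqVneq y 0.
  by rewrite /G mul0r sqrtr0 mulr0 entropy0 mulr0 subrr.
have [->|yn1] := eqVneq y 1.
  by rewrite -GC subrr /G mul0r sqrtr0 mulr0 entropy0 mulr0 subrr.
have yp : 0 < y by rewrite lt_neqAle eq_sym yn0.
have yp1 : y < 1 by rewrite lt_neqAle yn1.
have [yh|yh] := leP y (1 / 2); first by apply: half; lra.
by rewrite -GC; apply: half; lra.
Qed.

(** * Noise on one bit *)

Lemma expRN_le_quad (R : realType) (x : R) : 0 <= x ->
  expR (- x) <= 1 - x + x ^+ 2.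
Proof.
move=> x0; rewrite expRN.
have h := expR_ge1Dx x; have e0 := expR_gt0 x.
rewrite -[_^-1]mul1r ler_pdivrMr //.
have q0 : 0 <= 1 - x + x ^+ 2 by nra.
apply: le_trans (_ : (1 - x + x ^+ 2) * (1 + x) <= _); last by rewrite ler_wpM2l.
have : 0 <= x ^+ 3 by rewrite exprn_ge0.
have -> : (1 - x + x ^+ 2) * (1 + x) = 1 + x ^+ 3 by ring.
lra.
Qed.

(** Second order expansion of [expR (t * ln y)], uniform in [y]: the factor [y]
    makes the remainder y (ln y)^2 bounded. *)
Lemma powR1D_le_quad (R : realType) (y t : R) : 0 <= y <= 1 -> 0 <= t ->
  y `^ (1 + t) <= y + t * (y * ln y) + 4 * t ^+ 2.
Proof.
move=> /[dup] y01 /andP[y0 y1] t0.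
have [->|yn0] := eqVneq y 0.
  rewrite powR0 ?gt_eqF; [|lra|lra].
  by rewrite mul0r mulr0 !add0r mulr_ge0 ?sqr_ge0.
have yp : 0 < y by rewrite lt_neqAle eq_sym yn0.
rewrite powRD ?yn0 ?implybT // powRr1 // /powR (negbTE yn0).
have l0 : ln y <= 0 := ln_le0 y1.
have := @expRN_le_quad R (- (t * ln y)) _.
rewrite opprK sqrrN => /(_ _)/wrap[|h]; first by rewrite oppr_ge0 mulr_ge0_le0.
apply: le_trans (_ : y * (1 + t * ln y + (t * ln y) ^+ 2) <= _).
  by rewrite ler_wpM2l.
have /andP[s0 s2] := sqrt_mul_ln_bound y01.
have s4 : (Num.sqrt y * ln y) ^+ 2 <= 4 by nra.
rewrite exprMn sqr_sqrtr // in s4.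
have : t ^+ 2 * (y * ln y ^+ 2) <= t ^+ 2 * 4 by rewrite ler_wpM2l ?sqr_ge0.
rewrite exprMn; lra.
Qed.

Lemma sqr_powR (R : realType) (a t : R) : 0 <= a ->
  (a `^ ((1 + t) / 2)) ^+ 2 = a `^ (1 + t).
Proof.
by move=> a0; rewrite -powR_mulrn ?powR_ge0 // -powRrM divfK.
Qed.

(** The case of total mass 1. The exponent is [1 + c * q] on the diagonal,
    where its expansion produces [- c * q * entropy y]; off the diagonal the
    prefactor [q] allows the exponent [e] to be replaced by 1/2. *)
Lemma bit_norm_bound_unit (R : realType) (c q e y : R) :
  e = (1 + c * q) / 2 ->
  0 <= c -> 0 <= q <= 1 -> 0 <= y <= 1 ->
  (1 - q) * ((y `^ e) ^+ 2 + ((1 - y) `^ e) ^+ 2)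
    + 2 * q * (y `^ e * (1 - y) `^ e)
  <= 1 + (q * (2 * Num.sqrt (y * (1 - y)) - c * entropy y - 1)
          + q ^+ 2 * (c + 8 * c ^+ 2)).
Proof.
move=> eE c0 /andP[q0 q1] /[dup] y01 /andP[y0 y1].
have y1' : 0 <= 1 - y by lra.
have t0 : 0 <= c * q by rewrite mulr_ge0.
rewrite {1 2}eE !sqr_powR // -powRM //.
have h1 := @powR1D_le_quad R y _ y01 t0.
have h2 : (1 - y) `^ (1 + c * q)
    <= (1 - y) + c * q * ((1 - y) * ln (1 - y)) + 4 * (c * q) ^+ 2.
  by apply: powR1D_le_quad => //; lra.
have h3 : (y * (1 - y)) `^ e <= Num.sqrt (y * (1 - y)).
  have p0 : 0 <= y * (1 - y) by rewrite mulr_ge0.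
  rewrite -powR12_sqrt //.
  have [->|pn0] := eqVneq (y * (1 - y)) 0.
    by rewrite !powR0 ?gt_eqF ?invr_gt0 // eE; lra.
  apply: ger_powR; last by rewrite eE; lra.
  by rewrite lt_neqAle eq_sym pn0 p0 /=; nra.
have h4 := entropy_le1 y01.
have h5 : y `^ (1 + c * q) + (1 - y) `^ (1 + c * q)
    <= 1 - c * q * entropy y + 8 * (c * q) ^+ 2.
  by rewrite /entropy; lra.
have : (1 - q) * (y `^ (1 + c * q) + (1 - y) `^ (1 + c * q))
    <= (1 - q) * (1 - c * q * entropy y + 8 * (c * q) ^+ 2).
  by rewrite ler_wpM2l // subr_ge0.
have : 2 * q * (y * (1 - y)) `^ e <= 2 * q * Num.sqrt (y * (1 - y)).
  by rewrite ler_wpM2l // mulr_ge0.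
have : (c * q ^+ 2) * entropy y <= (c * q ^+ 2) * 1.
  by rewrite ler_wpM2l // mulr_ge0 // sqr_ge0.
have : 0 <= q * (c * q) ^+ 2 by rewrite mulr_ge0 // sqr_ge0.
lra.
Qed.

(** With [p = e^-1] and with [a], [b] the p-th powers of the two values of a
    function on one bit, this bounds its noise form by its squared p-norm. *)
Lemma bit_norm_bound (R : realType) (c q e G a b : R) :
  e = (1 + c * q) / 2 ->
  0 <= c -> 0 <= q <= 1 ->
  (forall y : R, 0 <= y <= 1 ->
    2 * Num.sqrt (y * (1 - y)) - c * entropy y <= G) ->
  0 <= a -> 0 <= b ->
  (1 - q) * ((a `^ e) ^+ 2 + (b `^ e) ^+ 2) + 2 * q * (a `^ e * b `^ e)
  <= expR (q * (G - 1) + q ^+ 2 * (c + 8 * c ^+ 2)) * ((a + b) `^ e) ^+ 2.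
Proof.
move=> eE c0 /[dup] q01 /andP[q0 q1] hG a0 b0.
have t0 : 0 <= c * q by rewrite mulr_ge0.
have [ab0|abn0] := eqVneq (a + b) 0.
  have [-> ->] : a = 0 /\ b = 0 by lra.
  have e0 : e != 0 by rewrite eE gt_eqF //; lra.
  by rewrite addr0 !powR0 //; lra.
have abp : 0 < a + b by rewrite lt_neqAle eq_sym abn0 addr_ge0.
pose y := a / (a + b).
have y01 : 0 <= y <= 1 by rewrite /y divr_ge0 ?ler_pdivrMr /=; lra.
have aE : a = (a + b) * y by rewrite /y mulrC divfK.
have bE : b = (a + b) * (1 - y) by rewrite mulrBr -aE; ring.
have /andP[y0 y1] := y01.
have -> : a `^ e = (a + b) `^ e * y `^ e by rewrite -powRM ?(ltW abp) // -aE.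
have -> : b `^ e = (a + b) `^ e * (1 - y) `^ e.
  by rewrite -powRM ?(ltW abp) ?subr_ge0 // -bE.
set S := _ `^ e.
have h := bit_norm_bound_unit eE c0 q01 y01.
have h2 : q * (2 * Num.sqrt (y * (1 - y)) - c * entropy y - 1) <= q * (G - 1).
  by rewrite ler_wpM2l // lerD2r hG.
have h3 := expR_ge1Dx (q * (G - 1) + q ^+ 2 * (c + 8 * c ^+ 2)).
have := sqr_ge0 S.
set A := y `^ e in h *; set B := (1 - y) `^ e in h *.
set E := expR _ in h3 *.
move=> S2.
have -> : (1 - q) * ((S * A) ^+ 2 + (S * B) ^+ 2) + 2 * q * (S * A * (S * B)) =
  ((1 - q) * (A ^+ 2 + B ^+ 2) + 2 * q * (A * B)) * S ^+ 2 by ring.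
by rewrite ler_wpM2r //; lra.
Qed.

(** Cauchy-Schwarz for the one-bit noise form, which is nonnegative because
    its determinant is [1 - 2 * q]. *)
Lemma bit_bilinear_bound (R : realType) (q K e : R) :
  0 <= q <= 1 / 2 -> 0 <= K ->
  (forall a b : R, 0 <= a -> 0 <= b ->
    (1 - q) * ((a `^ e) ^+ 2 + (b `^ e) ^+ 2) + 2 * q * (a `^ e * b `^ e)
    <= K * ((a + b) `^ e) ^+ 2) ->
  forall a b a' b' : R, 0 <= a -> 0 <= b -> 0 <= a' -> 0 <= b' ->
    (1 - q) * (a `^ e * a' `^ e + b `^ e * b' `^ e)
    + q * (a `^ e * b' `^ e + b `^ e * a' `^ e)
    <= K * ((a + b) `^ e * (a' + b') `^ e).
Proof.
move=> /andP[q0 q1] K0 hK a b a' b' a0 b0 a'0 b'0.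
have := hK a b a0 b0; have := hK a' b' a'0 b'0.
have := powR_ge0 (a + b) e; have := powR_ge0 (a' + b') e.
have := powR_ge0 a e; have := powR_ge0 b e.
have := powR_ge0 a' e; have := powR_ge0 b' e.
move: (a `^ e) (b `^ e) (a' `^ e) (b' `^ e) ((a + b) `^ e) ((a' + b') `^ e).
move=> A B A' B' S S' B'0 A'0 B0 A0 S'0 S0 h' h.
have q1' : 0 <= 1 - q by lra.
have form0 (x y : R) : 0 <= x -> 0 <= y ->
    0 <= (1 - q) * (x ^+ 2 + y ^+ 2) + 2 * q * (x * y).
  by move=> x0 y0; rewrite addr_ge0 // mulr_ge0 // ?addr_ge0 ?sqr_ge0 ?mulr_ge0.
have f0 : 0 <= (1 - q) * (A * A' + B * B') + q * (A * B' + B * A').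
  by rewrite addr_ge0 // mulr_ge0 // addr_ge0 // mulr_ge0.
rewrite -ler_sqr ?nnegrE ?mulr_ge0 //.
apply: (@le_trans _ _ (((1 - q) * (A ^+ 2 + B ^+ 2) + 2 * q * (A * B)) *
   ((1 - q) * (A' ^+ 2 + B' ^+ 2) + 2 * q * (A' * B')))); last first.
  have -> : (K * (S * S')) ^+ 2 = (K * S ^+ 2) * (K * S' ^+ 2) by ring.
  by apply: ler_pM => //; exact: form0.
rewrite -subr_ge0.
have -> : ((1 - q) * (A ^+ 2 + B ^+ 2) + 2 * q * (A * B)) *
   ((1 - q) * (A' ^+ 2 + B' ^+ 2) + 2 * q * (A' * B')) -
   ((1 - q) * (A * A' + B * B') + q * (A * B' + B * A')) ^+ 2 =
   (1 - 2 * q) * (A * B' - B * A') ^+ 2 by ring.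
by rewrite mulr_ge0 ?sqr_ge0 //; lra.
Qed.

(** * Tensorization over the cube *)

Lemma sum_F2 (V : nmodType) (F : 'F_2 -> V) : \sum_a F a = F 0 + F 1.
Proof.
rewrite (bigD1 (0 : 'F_2)) //= (bigD1 (1 : 'F_2)) //= big1 ?addr0 // => a.
by case: a => [[|[|?]]].
Qed.

(** Prepends one coordinate; an explicit isomorphism between 'F_2 times the
    n-cube and the next cube, on which all inductions on [n] rest. *)
Definition bcons n (a : 'F_2) (x : cube n) : cube n.+1 :=
  \row_j (if unlift ord0 j is Some i then x ord0 i else a).

Lemma bcons0 n a (x : cube n) : bcons a x ord0 ord0 = a.
Proof. by rewrite mxE unlift_none. Qed.

Lemma bconsS n a (x : cube n) i : bcons a x ord0 (lift ord0 i) = x ord0 i.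
Proof. by rewrite mxE liftK. Qed.

Lemma sum_cubeS (V : nmodType) n (F : cube n.+1 -> V) :
  \sum_x F x = \sum_(x : cube n) F (bcons 0 x) + \sum_(x : cube n) F (bcons 1 x).
Proof.
rewrite -(sum_F2 (fun a => \sum_(x : cube n) F (bcons a x))) pair_big /=.
rewrite (reindex (fun p : 'F_2 * cube n => bcons p.1 p.2)) //.
exists (fun x : cube n.+1 => (x ord0 ord0, \row_j x ord0 (lift ord0 j))).
  move=> [a x] _ /=; rewrite bcons0; congr pair.
  by apply/rowP => j; rewrite !mxE liftK.
move=> x _ /=; apply/rowP => j; rewrite !mxE.
by case: unliftP => [i ->|->] //; rewrite mxE.
Qed.

Lemma sum_cube0 (V : nmodType) (F : cube 0 -> V) : \sum_x F x = F 0.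
Proof.
by rewrite (bigD1 (0 : cube 0)) //= big1 ?addr0 // => x; rewrite thinmx0 eqxx.
Qed.

Lemma sum_cube_prod (A : comPzSemiRingType) n (F : 'I_n -> 'F_2 -> A) :
  \sum_(x : cube n) \prod_j F j (x ord0 j) = \prod_j (F j 0 + F j 1).
Proof.
elim: n F => [|n IH] F; first by rewrite sum_cube0 !big_ord0.
rewrite sum_cubeS big_ord_recl mulrDl -(IH (fun i => F (lift ord0 i))) !mulr_sumr.
by congr (_ + _); apply: eq_bigr => x _; rewrite big_ord_recl bcons0;
  congr (_ * _); apply: eq_bigr => j _; rewrite bconsS.
Qed.

(** Probability that [x] becomes [y] when every coordinate is flipped
    independently with probability [q]. *)
Definition noise (R : pzRingType) (q : R) n (x y : cube n) : R :=
  \prod_j (if x ord0 j == y ord0 j then 1 - q else q).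

(** Splitting off one coordinate turns the form into a 2 x 2 array of forms in
    one dimension less; the induction hypothesis bounds each of them by a
    product of powers of partial sums, and these partial sums are the data of
    the one-bit inequality. The statement is bilinear, rather than quadratic,
    for the sake of the off-diagonal entries of the array. *)
Lemma noise_norm_bound (R : realType) (q K e : R) :
  0 <= q <= 1 -> 0 <= K ->
  (forall a b a' b' : R, 0 <= a -> 0 <= b -> 0 <= a' -> 0 <= b' ->
    (1 - q) * (a `^ e * a' `^ e + b `^ e * b' `^ e)
    + q * (a `^ e * b' `^ e + b `^ e * a' `^ e)
    <= K * ((a + b) `^ e * (a' + b') `^ e)) ->
  forall n (f g : cube n -> R), (forall x, 0 <= f x) -> (forall x, 0 <= g x) ->
  \sum_x \sum_y noise q x y * (f x `^ e * g y `^ e)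
  <= K ^+ n * ((\sum_x f x) `^ e * (\sum_x g x) `^ e).
Proof.
move=> /andP[q0 q1] K0 hK; elim=> [|n IH] f g f0 g0.
  by rewrite !sum_cube0 /noise big_ord0 expr0.
have split a b : \sum_x \sum_y noise q (bcons a x) (bcons b y) *
    (f (bcons a x) `^ e * g (bcons b y) `^ e) =
    (if a == b then 1 - q else q) * \sum_(x : cube n) \sum_(y : cube n)
     noise q x y * (f (bcons a x) `^ e * g (bcons b y) `^ e).
  rewrite mulr_sumr; apply: eq_bigr => x _; rewrite mulr_sumr.
  apply: eq_bigr => y _; rewrite [RHS]mulrA; congr (_ * _).
  rewrite /noise big_ord_recl !bcons0; congr (_ * _).
  by apply: eq_bigr => j _; rewrite !bconsS.
rewrite sum_cubeS.
under eq_bigr do rewrite sum_cubeS.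
under [X in _ + X]eq_bigr do rewrite sum_cubeS.
rewrite !big_split /= !split /= ![\sum_(x : cube n.+1) _]sum_cubeS.
have ge a (h : cube n.+1 -> R) :
    (forall x, 0 <= h x) -> 0 <= \sum_(x : cube n) h (bcons a x).
  by move=> h0; apply: sumr_ge0.
have := hK _ _ _ _ (ge 0 f f0) (ge 1 f f0) (ge 0 g g0) (ge 1 g g0).
have IH' a b := IH (fun x => f (bcons a x)) (fun x => g (bcons b x))
  (fun x => f0 _) (fun x => g0 _).
have q1' : 0 <= 1 - q by rewrite subr_ge0.
move: (ler_wpM2l q1' (IH' 0 0)) (ler_wpM2l q0 (IH' 0 1))
  (ler_wpM2l q0 (IH' 1 0)) (ler_wpM2l q1' (IH' 1 1)).
move=> h1 h2 h3 h4 h; rewrite exprSr -mulrA.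
apply: le_trans (ler_wpM2l (exprn_ge0 n K0) h).
lra.
Qed.

(** * Fourier analysis *)

Definition sign2 (A : pzRingType) (a : 'F_2) : A := (-1) ^+ val a.

Lemma F2_cases (a : 'F_2) : a = 0 \/ a = 1.
Proof. by case: a => [[|[|?]]] // i; [left|right]; apply/val_inj. Qed.

Lemma sign2D (A : pzRingType) : {morph @sign2 A : a b / a + b >-> a * b}.
Proof.
move=> a b; case: (F2_cases a) => ->; case: (F2_cases b) => ->;
  by rewrite /sign2 /= ?expr0 ?expr1 ?mulr1 ?mul1r ?mulrNN ?mulr1.
Qed.

Lemma sign2_pairing (A : comPzRingType) n (w x : cube n) :
  (-1) ^+ val (pairing w x) = \prod_j sign2 A (w ord0 j * x ord0 j).
Proof. exact: (big_morph _ (@sign2D A) (erefl : sign2 A 0 = 1)). Qed.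

Lemma exp_weight (A : comPzSemiRingType) n (z : A) (w : cube n) :
  z ^+ weight w = \prod_j (if w ord0 j == 0 then 1 else z).
Proof.
rewrite /weight -prodr_const big_mkcond /=.
by apply: eq_bigr => j _; rewrite inE; case: eqP.
Qed.

(** The noise operator is diagonal in the basis of characters; both sides are
    products over the coordinates. *)
Lemma sum_weight_character (A : comPzRingType) n (q : A) (x y : cube n) :
  \sum_(w : cube n) (1 - 2 * q) ^+ weight w
     * ((-1) ^+ val (pairing w x) * (-1) ^+ val (pairing w y))
  = 2 ^+ n * noise q x y.
Proof.
under eq_bigr do rewrite exp_weight !sign2_pairing -!big_split /=.
rewrite (sum_cube_prod (fun j a => (if a == 0 then 1 else 1 - 2 * q) *
  (sign2 A (a * x ord0 j) * sign2 A (a * y ord0 j)))).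
rewrite -[2 ^+ n](_ : \prod_(j < n) 2 = _); last first.
  by rewrite prodr_const card_ord.
rewrite /noise -big_split /=; apply: eq_bigr => j _.
rewrite !mul0r !mul1r.
case: (F2_cases (x ord0 j)) => ->; case: (F2_cases (y ord0 j)) => ->;
  rewrite /sign2 /= ?expr0 ?expr1; ring.
Qed.

Section Modulus.
Variable R : realType.
Implicit Types z : R[i].

(** The modulus, as an element of [R]. *)
Definition cabs z : R := complex.Re `|z|.

Lemma cabsE z : (cabs z)%:C = `|z|.
Proof. by rewrite /cabs RRe_real // normr_real. Qed.

Lemma cabs_ge0 z : 0 <= cabs z.
Proof. by rewrite -ler0c cabsE normr_ge0. Qed.

Lemma cabsM z z' : cabs (z * z') = cabs z * cabs z'.
Proof. by apply: complexI; rewrite rmorphM !cabsE normrM. Qed.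

Lemma cabs_real (r : R) : cabs r%:C = `|r|.
Proof. by rewrite /cabs normc_def /= expr0n addr0 sqrtr_sqr. Qed.

Lemma cabs_conj z : cabs (conjc z) = cabs z.
Proof. by apply: complexI; rewrite !cabsE normcJ. Qed.

Lemma cabs_eq0 z : (cabs z == 0) = (z == 0).
Proof. by rewrite -(inj_eq (@complexI R)) cabsE normr_eq0. Qed.

Lemma mul_conj z : z * conjc z = (cabs z ^+ 2)%:C.
Proof. by rewrite rmorphXn /= cabsE sqr_normc. Qed.

Lemma cabs_sum (I : finType) (P : pred I) (F : I -> R[i]) :
  cabs (\sum_(i | P i) F i) <= \sum_(i | P i) cabs (F i).
Proof.
rewrite -lecR rmorph_sum /= cabsE; under [leRHS]eq_bigr do rewrite cabsE.
exact: ler_norm_sum.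
Qed.

End Modulus.

Definition energy (R : realType) n (f : cfun R n) : R := \sum_x cabs (f x) ^+ 2.

Section Fourier.
Variables (R : realType) (n : nat).
Implicit Types f g : cfun R n.

Lemma conj_sign m : conjc ((-1) ^+ m : R[i]) = (-1) ^+ m.
Proof. by rewrite (rmorphXn (@conjc R)) rmorphN1. Qed.

Lemma sum_exchange4 f g (c : cube n -> cube n -> cube n -> R[i]) :
  \sum_w (\sum_x \sum_y c w x y * (f x * conjc (g y))) =
  \sum_x \sum_y (\sum_w c w x y) * (f x * conjc (g y)).
Proof.
rewrite exchange_big; apply: eq_bigr => x _.
rewrite exchange_big; apply: eq_bigr => y _.
by rewrite mulr_suml.
Qed.

(** The case [q = 0] is Parseval's identity. *)
Lemma weighted_parseval (q : R) f g :
  \sum_w (1 - 2 * q%:C) ^+ weight w * (fourier f w * conjc (fourier g w))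
  = 2 ^+ n * \sum_x \sum_y noise q%:C x y * (f x * conjc (g y)).
Proof.
transitivity (\sum_(w : cube n) \sum_x \sum_y
  ((1 - 2 * q%:C) ^+ weight w
     * ((-1) ^+ val (pairing w x) * (-1) ^+ val (pairing w y)))
    * (f x * conjc (g y))).
  apply: eq_bigr => w _; rewrite !ffunE rmorph_sum /= big_distrlr /= mulr_sumr.
  apply: eq_bigr => x _; rewrite mulr_sumr; apply: eq_bigr => y _.
  by rewrite rmorphM /= conj_sign -[RHS]mulrA mulrACA.
rewrite sum_exchange4 mulr_sumr; apply: eq_bigr => x _.
rewrite mulr_sumr; apply: eq_bigr => y _.
by rewrite sum_weight_character -mulrA.
Qed.

Lemma noise0 (x y : cube n) : noise (0 : R[i]) x y = (x == y)%:R.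
Proof.
rewrite /noise; have [->|xy] := eqVneq x y.
  by rewrite big1 // => j _; rewrite eqxx subr0.
have [j xyj] : exists j, x ord0 j != y ord0 j.
  apply/existsP; rewrite -negb_forall; apply: contra xy => /forallP h.
  by apply/eqP/rowP => j; apply/eqP.
by rewrite (bigD1 j) //= (negbTE xyj) mul0r.
Qed.

Lemma parseval f g :
  \sum_w fourier f w * conjc (fourier g w) = 2 ^+ n * \sum_x f x * conjc (g x).
Proof.
have := weighted_parseval 0 f g; rewrite mulr0 subr0.
under eq_bigr do rewrite expr1n mul1r.
move=> ->; congr (_ * _); apply: eq_bigr => x _.
rewrite (bigD1 x) //= noise0 eqxx mul1r big1 ?addr0 // => y yx.
by rewrite noise0 eq_sym (negbTE yx) mul0r.
Qed.

Lemma energyE f : (energy f)%:C = \sum_x f x * conjc (f x).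
Proof. by rewrite /energy rmorph_sum /=; apply: eq_bigr => x _; rewrite mul_conj. Qed.

Lemma energy_fourier f : energy (fourier f) = 2 ^+ n * energy f.
Proof.
by apply: complexI; rewrite energyE parseval rmorphM rmorphXn /= energyE rmorph_nat.
Qed.

Lemma energy_ge0 f : 0 <= energy f.
Proof. by apply: sumr_ge0 => x _; rewrite sqr_ge0. Qed.

Lemma energy_eq0 f : (energy f == 0) = (f == 0).
Proof.
apply/idP/eqP => [|->]; last first.
  by rewrite /energy big1 // => x _; rewrite ffunE
    -[0 : R[i]]/(0%:C) cabs_real normr0 expr0n.
rewrite psumr_eq0 => [/allP h|x _]; last exact: sqr_ge0.
apply/ffunP => x; have := h x (mem_index_enum x).
by rewrite /= sqrf_eq0 cabs_eq0 ffunE => /eqP.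
Qed.

Lemma energy_gt0 f : f != 0 -> 0 < energy f.
Proof. by move=> f0; rewrite lt_neqAle eq_sym energy_eq0 f0 energy_ge0. Qed.

Lemma fourierK f : fourier (fourier f) = [ffun x => 2 ^+ n * f x].
Proof.
apply/ffunP => y; rewrite !ffunE.
under eq_bigr => w _ do rewrite ffunE mulr_sumr.
rewrite exchange_big /= (bigD1 y) //= [X in _ + X]big1 ?addr0.
  have := @sum_weight_character R[i] n 0 y y.
  rewrite noise0 eqxx mulr1 => <-; rewrite mulr_suml; apply: eq_bigr => w _.
  rewrite mulr0 subr0 expr1n mul1r mulrA; congr (_ ^+ val _ * _ * _).
  by apply: eq_bigr => j _; rewrite mulrC.
move=> x xy; have := @sum_weight_character R[i] n 0 y x.
rewrite noise0 eq_sym (negbTE xy) /= mulr0n !mulr0 => h.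
move/(congr1 (fun z => z * f x)): h; rewrite mul0r mulr_suml => h.
rewrite -[RHS]h; apply: eq_bigr => w _.
rewrite subr0 expr1n mul1r mulrA; congr (_ ^+ val _ * _ * _).
by apply: eq_bigr => j _; rewrite mulrC.
Qed.

End Fourier.

(** * Angles and spectral mass *)

Lemma sum_cauchy_schwarz (R : rcfType) (I : finType) (P : pred I) (a b : I -> R) :
  (forall i, 0 <= a i) -> (forall i, 0 <= b i) ->
  \sum_(i | P i) a i * b i
    <= Num.sqrt (\sum_(i | P i) a i ^+ 2) * Num.sqrt (\sum_(i | P i) b i ^+ 2).
Proof.
move=> a0 b0.
have sq0 (c : I -> R) : 0 <= \sum_(i | P i) c i ^+ 2.
  by apply: sumr_ge0 => i _; exact: sqr_ge0.
rewrite -sqrtrM // -[leLHS]ger0_norm; last by apply: sumr_ge0 => i _; rewrite mulr_ge0.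
rewrite -sqrtr_sqr ler_wsqrtr // -subr_ge0.
set A := \sum_(i | P i) a i ^+ 2; set B := \sum_(i | P i) b i ^+ 2.
set S := \sum_(i | P i) _.
have : 0 <= \sum_(i | P i) \sum_(j | P j) (a i * b j - a j * b i) ^+ 2.
  by apply: sumr_ge0 => i _; apply: sumr_ge0 => j _; exact: sqr_ge0.
have -> : \sum_(i | P i) \sum_(j | P j) (a i * b j - a j * b i) ^+ 2 =
    \sum_(i | P i) \sum_(j | P j) a i ^+ 2 * b j ^+ 2
    + \sum_(i | P i) \sum_(j | P j) b i ^+ 2 * a j ^+ 2
    - 2 * \sum_(i | P i) \sum_(j | P j) (a i * b i) * (a j * b j).
  rewrite mulr_sumr -big_split -sumrB; apply: eq_bigr => i _.
  rewrite mulr_sumr -big_split -sumrB; apply: eq_bigr => j _ /=; ring.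
rewrite -!big_distrlr /= -/A -/B -/S; lra.
Qed.

Section Angle.
Variables (R : realType) (n : nat).
Implicit Types (f g : cfun R n) (S Sigma : {set cube n}).

Let pow2_gt0 : 0 < 2 ^+ n :> R. Proof. by rewrite exprn_gt0. Qed.

Lemma pow2C : 2 ^+ n = (2 ^+ n)%:C :> R[i].
Proof. by rewrite rmorphXn /= rmorph_nat. Qed.

Lemma innerE f g : inner f g = ((2 ^+ n)^-1)%:C * \sum_x f x * conjc (g x).
Proof.
rewrite /inner card_mx card_Fp // mul1n; congr (_ * _).
by rewrite natrX fmorphV rmorphXn /= rmorph_nat.
Qed.

Lemma inner_fourier f g :
  inner f g = ((2 ^+ n)^-1 ^+ 2)%:C * \sum_w fourier f w * conjc (fourier g w).
Proof.
rewrite innerE parseval mulrA; congr (_ * _).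
rewrite pow2C -rmorphM /=; congr (_%:C).
by field; rewrite gt_eqF.
Qed.

Lemma norm2E f : norm2 f = Num.sqrt ((2 ^+ n)^-1 * energy f).
Proof. by rewrite /norm2 innerE -energyE -rmorphM. Qed.

Lemma norm2_gt0 f : f != 0 -> 0 < norm2 f.
Proof.
by move=> f0; rewrite norm2E sqrtr_gt0 mulr_gt0 ?invr_gt0 ?energy_gt0.
Qed.

Lemma sqrt_energy f : Num.sqrt (2 ^+ n * energy f) = 2 ^+ n * norm2 f.
Proof.
have -> : 2 ^+ n * energy f = (2 ^+ n) ^+ 2 * ((2 ^+ n)^-1 * energy f).
  by field; rewrite gt_eqF.
by rewrite sqrtrM ?sqr_ge0 // sqrtr_sqr ger0_norm ?ltW // -norm2E.
Qed.

Definition spectral_mass Sigma f : R := \sum_(w in Sigma) cabs (fourier f w) ^+ 2.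

Lemma spectral_mass_le Sigma f : spectral_mass Sigma f <= 2 ^+ n * energy f.
Proof.
rewrite -energy_fourier /energy /spectral_mass big_mkcond /=.
by apply: ler_sum => w _; case: ifP => // _; exact: sqr_ge0.
Qed.

(** Only the frequencies in [Sigma] contribute to the inner product, and
    Cauchy-Schwarz applies on them. For [d = 1] the hypothesis on [f] always
    holds. *)
Lemma inner_le Sigma f g (d : R) : 0 <= d -> V_freq R Sigma g ->
  spectral_mass Sigma f <= d ^+ 2 * (2 ^+ n * energy f) ->
  cabs (inner f g) <= d * (norm2 f * norm2 g).
Proof.
move=> d0 /supportP gS fS.
rewrite inner_fourier (bigID (mem Sigma)) /= [X in _ + X]big1 ?addr0; last first.
  by move=> w /gS ->; rewrite conjc0 mulr0.
rewrite cabsM cabs_real ger0_norm ?sqr_ge0 //.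
have h1 : cabs (\sum_(w in Sigma) fourier f w * conjc (fourier g w)) <=
    Num.sqrt (spectral_mass Sigma f) * Num.sqrt (spectral_mass Sigma g).
  apply: le_trans (cabs_sum _ _) _.
  under eq_bigr do rewrite cabsM cabs_conj.
  by apply: sum_cauchy_schwarz => w; exact: cabs_ge0.
have h2 : Num.sqrt (spectral_mass Sigma f) <= d * (2 ^+ n * norm2 f).
  apply: le_trans (ler_wsqrtr fS) _.
  by rewrite sqrtrM ?sqr_ge0 // sqrtr_sqr ger0_norm // sqrt_energy.
have h3 : Num.sqrt (spectral_mass Sigma g) <= 2 ^+ n * norm2 g.
  by rewrite -sqrt_energy ler_wsqrtr // spectral_mass_le.
have h : cabs (\sum_(w in Sigma) fourier f w * conjc (fourier g w))
  <= (d * (2 ^+ n * norm2 f)) * (2 ^+ n * norm2 g).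
  by apply: le_trans h1 _; apply: ler_pM; rewrite ?sqrtr_ge0.
rewrite exprVn mulrC ler_pdivrMr ?exprn_gt0 //.
by apply: le_trans h _; rewrite le_eqVlt; apply/orP; left; apply/eqP; ring.
Qed.

Lemma cos_angle_le S Sigma (d : R) : 0 <= d ->
  (forall f, V_time R S f ->
     spectral_mass Sigma f <= d ^+ 2 * (2 ^+ n * energy f)) ->
  cos_angle (V_time R S) (V_freq R Sigma) <= d.
Proof.
move=> d0 h; rewrite /cos_angle; set E := [set c | _]%classic.
have [->|/set0P E0] := eqVneq E set0; first by rewrite sup0.
apply: ge_sup => // _ [f1 [f2 [Sf1 Sf2 f10 f20 ->]]].
rewrite ler_pdivrMr ?mulr_gt0 ?norm2_gt0 //.
by apply: (inner_le (Sigma := Sigma)) => //; exact: h.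
Qed.

Lemma fourier_scale (c : R[i]) f :
  fourier [ffun x => c * f x] = [ffun w => c * fourier f w].
Proof.
apply/ffunP => w; rewrite !ffunE mulr_sumr; apply: eq_bigr => x _.
by rewrite ffunE mulrCA.
Qed.

Definition lowpass Sigma f : cfun R n :=
  [ffun x => (2 ^+ n)^-1 *
    fourier [ffun w => if w \in Sigma then fourier f w else 0] x].

Lemma fourier_lowpass Sigma f w :
  fourier (lowpass Sigma f) w = if w \in Sigma then fourier f w else 0.
Proof.
rewrite fourier_scale fourierK [LHS]ffunE [X in _ * X]ffunE mulKf; last first.
  by rewrite expf_eq0 pnatr_eq0 andbF.
exact: ffunE.
Qed.

Lemma energy_lowpass Sigma f : 2 ^+ n * energy (lowpass Sigma f) = spectral_mass Sigma f.
Proof.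
rewrite -energy_fourier /energy /spectral_mass [RHS]big_mkcond.
apply: eq_bigr => w _; rewrite fourier_lowpass; case: ifP => // _.
by rewrite -[0 : R[i]]/(0%:C) cabs_real normr0 expr0n.
Qed.

Lemma inner_lowpass Sigma f :
  inner f (lowpass Sigma f) = ((2 ^+ n)^-1 * energy (lowpass Sigma f))%:C.
Proof.
rewrite inner_fourier.
transitivity (((2 ^+ n)^-1 ^+ 2)%:C * (spectral_mass Sigma f)%:C).
  congr (_ * _); rewrite /spectral_mass rmorph_sum /= [RHS]big_mkcond.
  apply: eq_bigr => w _; rewrite fourier_lowpass; case: ifP => _; first exact: mul_conj.
  by rewrite conjc0 mulr0.
rewrite -energy_lowpass -rmorphM /=; congr (_%:C).
by field; rewrite gt_eqF.
Qed.

(** The witnesses are [f] and its truncation to the frequencies in [Sigma]: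
    their cosine is the square root of the fraction of the energy kept. *)
Lemma cos_angle_ge S Sigma (d : R) f : V_time R S f -> f != 0 -> d < 1 ->
  spectral_mass (~: Sigma) f <= d * (2 ^+ n * energy f) ->
  1 - d <= cos_angle (V_time R S) (V_freq R Sigma).
Proof.
move=> Sf f0 d1 fS.
have e0 := energy_gt0 f0.
have massE : spectral_mass Sigma f + spectral_mass (~: Sigma) f = 2 ^+ n * energy f.
  rewrite -energy_fourier /energy (bigID (mem Sigma)) /=; congr (_ + _).
  by apply: eq_bigl => w; rewrite inE.
set g := lowpass Sigma f.
have ge : (1 - d) * energy f <= energy g.
  by rewrite -(ler_pM2l pow2_gt0) energy_lowpass; lra.
have le : energy g <= energy f.
  by rewrite -(ler_pM2l pow2_gt0) energy_lowpass spectral_mass_le.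
have g0 : g != 0.
  by rewrite -energy_eq0 gt_eqF // (lt_le_trans _ ge) // mulr_gt0 // subr_gt0.
have Sg : V_freq R Sigma g.
  by apply/supportP => w /negbTE wS; rewrite fourier_lowpass wS.
set c := cabs (inner f g) / (norm2 f * norm2 g).
have hc : 1 - d <= c.
  rewrite ler_pdivlMr ?mulr_gt0 ?norm2_gt0 // inner_lowpass cabs_real.
  rewrite ger0_norm; last first.
    by rewrite mulr_ge0 ?energy_ge0 // invr_ge0 ltW.
  apply: le_trans (_ : (1 - d) * ((2 ^+ n)^-1 * energy f) <= _); last first.
    by rewrite mulrCA ler_pM2l ?invr_gt0.
  rewrite ler_pM2l ?subr_gt0 // !norm2E.
  apply: le_trans (_ : Num.sqrt ((2 ^+ n)^-1 * energy f) ^+ 2 <= _).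
    by rewrite expr2 ler_wpM2l ?sqrtr_ge0 // ler_wsqrtr // ler_pM2l ?invr_gt0.
  by rewrite sqr_sqrtr // mulr_ge0 ?energy_ge0 // invr_ge0 ltW.
apply: le_trans hc _; apply: ub_le_sup; last by exists f, g.
exists 1 => _ [f1 [f2 [_ Sf2 f10 f20 ->]]].
rewrite ler_pdivrMr ?mulr_gt0 ?norm2_gt0 //.
by apply: (inner_le (Sigma := Sigma)) => //; rewrite expr1n mul1r spectral_mass_le.
Qed.

End Angle.

(** * Noise forms on small sets *)

(** Young's inequality for the conjugate exponents [1 + t] and [(1 + t) / t]:
    the graph of the power [1 + t] lies above its tangent at [m]. *)
Lemma powR_tangent (R : realType) (t a m : R) : 0 < t -> 0 <= a -> 0 <= m ->
  (1 + t) * (m `^ t * a) <= a `^ (1 + t) + t * m `^ (1 + t).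
Proof.
move=> t0 a0 m0.
have t1 : 0 < 1 + t by lra.
have := @conjugate_powR R a (m `^ t) (1 + t) ((1 + t) / t) a0 (powR_ge0 _ _) t1 _ _.
rewrite -powRrM mulrCA divff ?gt_eqF // mulr1 => h.
have {}h : a * m `^ t <= a `^ (1 + t) / (1 + t) + m `^ (1 + t) / ((1 + t) / t).
  by apply: h; [rewrite divr_gt0|field; apply/andP; split; lra].
rewrite -(ler_pM2l t1) in h.
rewrite [m `^ t * a]mulrC; apply: le_trans h _.
rewrite le_eqVlt; apply/orP; left; apply/eqP; field; apply/andP; split; lra.
Qed.

Lemma power_mean (R : realType) (I : finType) (S : {set I}) (t : R) (a : I -> R) :
  0 < t -> (forall i, 0 <= a i) ->
  (\sum_(i in S) a i) `^ (1 + t) <= #|S|%:R `^ t * \sum_(i in S) a i `^ (1 + t).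
Proof.
move=> t0 a0.
have [->|S0] := eqVneq S finset.set0.
  by rewrite !big_set0 mulr0 powR0 // gt_eqF //; lra.
have N0 : 0 < #|S|%:R :> R by rewrite ltr0n card_gt0.
set N := #|S|%:R in N0 *.
pose m := (\sum_(i in S) a i) / N.
have m0 : 0 <= m by rewrite divr_ge0 ?(ltW N0) ?sumr_ge0.
have mE : \sum_(i in S) a i = N * m by rewrite /m mulrC divfK // gt_eqF.
have : \sum_(i in S) (1 + t) * (m `^ t * a i)
    <= \sum_(i in S) (a i `^ (1 + t) + t * m `^ (1 + t)).
  by apply: ler_sum => i _; exact: powR_tangent.
rewrite -!mulr_sumr mE big_split /= sumr_const -mulr_natl -/N => h.
have pD (x : R) : 0 <= x -> x `^ (1 + t) = x * x `^ t.
  rewrite le_eqVlt => /predU1P[<-|x0].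
    by rewrite mul0r powR0 // gt_eqF //; lra.
  by rewrite powRD ?powRr1 ?(ltW x0) // (gt_eqF x0) implybT.
rewrite powRM ?(ltW N0) // pD ?(ltW N0) //.
rewrite [N * N `^ t]mulrC -mulrA ler_wpM2l ?powR_ge0 //.
have e : m `^ t * (N * m) = N * m `^ (1 + t) by rewrite pD //; ring.
by rewrite e in h; lra.
Qed.

(** Tensorized inequality with [e^-1] as the exponent of the norm, followed by
    the comparison of this norm with the 2-norm on [S]; the comparison gains a
    power of [#|S|] because [e^-1] is less than 2. *)
Lemma noise_form_le (R : realType) (n : nat) (q K t e : R) (S : {set cube n})
    (f : cube n -> R) :
  0 < t -> e = (1 + t) / 2 -> 0 <= q <= 1 -> 0 <= K ->
  (forall a b a' b' : R, 0 <= a -> 0 <= b -> 0 <= a' -> 0 <= b' ->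
    (1 - q) * (a `^ e * a' `^ e + b `^ e * b' `^ e)
    + q * (a `^ e * b' `^ e + b `^ e * a' `^ e)
    <= K * ((a + b) `^ e * (a' + b') `^ e)) ->
  (forall x, 0 <= f x) -> (forall x, x \notin S -> f x = 0) ->
  \sum_x \sum_y noise q x y * (f x * f y)
  <= K ^+ n * (#|S|%:R `^ t * \sum_x f x ^+ 2).
Proof.
move=> t0 eE q01 K0 hK f0 fS.
have e0 : 0 < e by rewrite eE divr_gt0 //; lra.
pose F x := f x `^ e^-1.
have FE x : f x = F x `^ e by rewrite /F -powRrM mulVf ?gt_eqF // powRr1.
have F0 x : 0 <= F x by exact: powR_ge0.
have := @noise_norm_bound R q K e q01 K0 hK n F F F0 F0.
under eq_bigr do under eq_bigr do rewrite -!FE.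
move=> /le_trans; apply; rewrite ler_wpM2l ?exprn_ge0 //.
rewrite -expr2 {1}eE sqr_powR ?sumr_ge0 //.
have FS : \sum_x F x = \sum_(x in S) F x.
  rewrite (bigID (mem S)) /= [X in _ + X]big1 ?addr0 // => x /fS fx.
  by rewrite /F fx powR0 // invr_eq0 gt_eqF.
have fS2 : \sum_x f x ^+ 2 = \sum_(x in S) F x `^ (1 + t).
  rewrite (bigID (mem S)) /= [X in _ + X]big1 ?addr0 => [|x /fS ->]; last by rewrite expr0n.
  by apply: eq_bigr => x _; rewrite FE {1}eE sqr_powR.
by rewrite FS fS2; exact: power_mean.
Qed.

Lemma weighted_spectral_mass_le (R : realType) (n : nat) (q : R) (f : cfun R n) :
  0 <= q <= 1 / 2 ->
  \sum_w (1 - 2 * q) ^+ weight w * cabs (fourier f w) ^+ 2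
  <= 2 ^+ n * \sum_x \sum_y noise q x y * (cabs (f x) * cabs (f y)).
Proof.
move=> /andP[q0 q1].
have nE (x y : cube n) : noise q%:C x y = (noise q x y)%:C.
  by rewrite /noise rmorph_prod; apply: eq_bigr => j _; case: ifP => //; rewrite rmorphB.
have n0 (x y : cube n) : 0 <= noise q x y.
  by apply: prodr_ge0 => j _; case: ifP => // _; lra.
have E : (\sum_w (1 - 2 * q) ^+ weight w * cabs (fourier f w) ^+ 2)%:C =
    2 ^+ n * \sum_x \sum_y noise q%:C x y * (f x * conjc (f y)).
  rewrite -weighted_parseval rmorph_sum /=; apply: eq_bigr => w _.
  by rewrite mul_conj rmorphM rmorphXn rmorphB rmorphM /= rmorph_nat.
rewrite -[leLHS]ger0_norm; last first.
  by apply: sumr_ge0 => w _; rewrite mulr_ge0 ?sqr_ge0 // exprn_ge0 //; lra.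
rewrite -cabs_real E cabsM.
rewrite pow2C cabs_real ger0_norm ?exprn_ge0 //.
rewrite ler_wpM2l ?exprn_ge0 //.
apply: le_trans (cabs_sum _ _) _; apply: ler_sum => x _.
apply: le_trans (cabs_sum _ _) _; apply: ler_sum => y _.
by rewrite !cabsM cabs_conj nE cabs_real ger0_norm.
Qed.

(** * Uncertainty principle for small sets *)

(** The constant [2 * q + 8 * q ^+ 2] is an upper bound for
    [- ln (1 - 2 * q)] when [q] is at most 1/4. *)
Lemma spectral_mass_ball_le (R : realType) (n : nat) (q r : R) (f : cfun R n) :
  0 <= q <= 1 / 4 ->
  spectral_mass (hball n r) f
  <= expR ((2 * q + 8 * q ^+ 2) * r)
     * \sum_w (1 - 2 * q) ^+ weight w * cabs (fourier f w) ^+ 2.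
Proof.
move=> /andP[q0 q1]; set s := 2 * q + 8 * q ^+ 2.
have s0 : 0 <= s by rewrite addr_ge0 // mulr_ge0 // sqr_ge0.
have h1 : 1 <= expR s * (1 - 2 * q).
  apply: le_trans (_ : (1 + s) * (1 - 2 * q) <= _); first by rewrite /s; nra.
  by rewrite ler_wpM2r ?expR_ge1Dx //; lra.
have z0 (w : cube n) : 0 <= (1 - 2 * q) ^+ weight w by rewrite exprn_ge0 //; lra.
rewrite /spectral_mass big_mkcond mulr_sumr; apply: ler_sum => w _.
case: ifP => [|_]; last by rewrite mulr_ge0 ?expR_ge0 // mulr_ge0 ?sqr_ge0.
rewrite inE => wr; rewrite mulrA ler_peMl ?sqr_ge0 //.
apply: le_trans (_ : (expR s * (1 - 2 * q)) ^+ weight w <= _).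
  by rewrite exprn_ege1.
by rewrite exprMn ler_wpM2r // -expRM_natr ler_expR ler_wpM2l.
Qed.

(** The three exponential factors (ball, one-bit constant to the power [n],
    cardinal of [S]) have exponents summing to
    [n * (- q * gap + O(q ^+ 2))], where [gap] is the difference of the two
    sides of the hypothesis; [q] is chosen to keep half of the linear term. *)
Lemma uncertainty_interior (R : realType) (rho1 rho2 : R) :
  0 < rho1 < 1 / 2 -> 0 <= rho2 <= 1 / 2 ->
  2 * Num.sqrt (rho1 * (1 - rho1)) < 1 - 2 * rho2 ->
  exists2 eps : R, 0 < eps & forall (n : nat) (S : {set cube n}),
    #|S|%:R <= expR (n%:R * entropy rho1) ->
    cos_angle (V_time R S) (V_freq R (hball n (rho2 * n%:R)))
      <= expR (- (n%:R * eps)).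
Proof.
move=> rho1_itv /andP[r0 r1] gap0.
have [c c0 hc] := sqrt_le_entropy_tangent rho1_itv.
set s := Num.sqrt _ in gap0 hc; set h := entropy rho1 in hc *.
pose gap := 1 - 2 * rho2 - 2 * s.
pose C := c + 8 * c ^+ 2.
have C0 : 0 < C by rewrite addr_gt0 // mulr_gt0 // exprn_gt0.
pose q := Num.min (1 / 4) (gap / (2 * (4 + C))).
have q0 : 0 < q.
  by rewrite lt_min; apply/andP; split; [|apply: divr_gt0]; rewrite /gap; lra.
have q1 : q <= 1 / 4 by rewrite ge_min lexx.
have q2 : q * (4 + C) <= gap / 2.
  have -> : gap / 2 = gap / (2 * (4 + C)) * (4 + C) by field; lra.
  by rewrite ler_wpM2r ?ge_min ?lexx ?orbT //; lra.
have t0 : 0 < c * q by rewrite mulr_gt0.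
pose K := expR (q * (2 * s - c * h - 1) + q ^+ 2 * C).
have K0 : 0 <= K by exact: expR_ge0.
exists (q * gap / 4); first by rewrite divr_gt0 // mulr_gt0 // /gap; lra.
move=> n S Sh; apply: cos_angle_le; first exact: expR_ge0.
move=> f /supportP fS.
have q14 : 0 <= q <= 1 / 4 by rewrite ltW.
apply: le_trans (spectral_mass_ball_le _ _ q14) _.
have q12 : 0 <= q <= 1 / 2 by lra.
have q11 : 0 <= q <= 1 by lra.
have noise_le : \sum_x \sum_y noise q x y * (cabs (f x) * cabs (f y))
    <= K ^+ n * (#|S|%:R `^ (c * q) * energy f).
  apply: (noise_form_le t0 (erefl _) q11 K0).
  - move=> a b a' b' a0 b0 a'0 b'0; apply: bit_bilinear_bound => //.
    by move=> u v u0 v0; apply: (bit_norm_bound (erefl _) (ltW c0) q11 hc).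
  - by move=> x; exact: cabs_ge0.
  - by move=> x /fS ->; rewrite -[0 : R[i]]/(0%:C) cabs_real normr0.
set B := expR _.
have B0 : 0 <= B by exact: expR_ge0.
have E0 := energy_ge0 f.
apply: le_trans (ler_wpM2l B0 (weighted_spectral_mass_le f q12)) _.
have two0 : 0 <= 2 ^+ n :> R by rewrite exprn_ge0.
apply: le_trans (ler_wpM2l B0 (ler_wpM2l two0 noise_le)) _.
have -> : B * (2 ^+ n * (K ^+ n * (#|S|%:R `^ (c * q) * energy f))) =
   (B * K ^+ n * #|S|%:R `^ (c * q)) * (2 ^+ n * energy f) by ring.
rewrite ler_wpM2r ?mulr_ge0 //.
have Sle : #|S|%:R `^ (c * q) <= expR (n%:R * h * (c * q)).
  by rewrite expRM ge0_ler_powR ?nnegrE ?expR_ge0 // ltW.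
apply: le_trans (_ : B * K ^+ n * expR (n%:R * h * (c * q)) <= _).
  by rewrite ler_wpM2l // mulr_ge0 // exprn_ge0.
rewrite /B /K -expRM_natl -!expRD -expRM_natl ler_expR.
have : n%:R * (q * (8 * rho2 + C) * q) <= n%:R * (gap / 2 * q).
  rewrite ler_wpM2l // ler_wpM2r ?(ltW q0) //.
  apply: le_trans q2; rewrite ler_wpM2l ?(ltW q0) //; lra.
have : 0 <= n%:R :> R by [].
rewrite /gap; lra.
Qed.

(** At [rho1 = 0] the tangent is vertical; as the hypothesis is open, [rho1] is
    then replaced by a small positive [x], which only weakens the condition on
    the cardinal of [S]. *)
Lemma uncertainty (R : realType) (rho1 rho2 : R) :
  0 <= rho1 <= 1 / 2 -> 0 <= rho2 <= 1 / 2 ->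
  (1 - 2 * rho1) ^+ 2 + (1 - 2 * rho2) ^+ 2 > 1 ->
  exists2 eps : R, 0 < eps & forall (n : nat) (S : {set cube n}),
    #|S|%:R <= expR (n%:R * entropy rho1) ->
    cos_angle (V_time R S) (V_freq R (hball n (rho2 * n%:R)))
      <= expR (- (n%:R * eps)).
Proof.
move=> /andP[a0 a1] /[dup] rho2_itv /andP[b0 b1] h.
have sqrt_lt (x : R) : 0 <= x <= 1 -> 4 * (x * (1 - x)) < (1 - 2 * rho2) ^+ 2 ->
    2 * Num.sqrt (x * (1 - x)) < 1 - 2 * rho2.
  move=> /andP[x0 x1] hx.
  have p0 : 0 <= x * (1 - x) by rewrite mulr_ge0 // subr_ge0.
  rewrite -ltr_sqr ?nnegrE ?mulr_ge0 ?sqrtr_ge0 //; last by lra.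
  rewrite exprMn sqr_sqrtr //; lra.
have [a00|an0] := eqVneq rho1 0; last first.
  apply: uncertainty_interior => //.
    rewrite lt_neqAle eq_sym an0 a0 /= lt_neqAle a1 andbT.
    by apply/eqP => aE; rewrite aE in h; nra.
  by apply: sqrt_lt; lra.
pose g := 1 - 2 * rho2.
have g0 : 0 < g by rewrite a00 in h; rewrite /g; nra.
pose x := (g / 4) ^+ 2.
have x0 : 0 < x by rewrite exprn_gt0 // divr_gt0.
have g1 : g <= 1 by rewrite /g; lra.
have x1 : 4 * x < g ^+ 2 by rewrite /x; nra.
have x2 : x < 1 / 2 by nra.
have x_itv : 0 < x < 1 / 2 by rewrite x0.
have [|eps eps0 heps] := uncertainty_interior x_itv rho2_itv.
  by apply: sqrt_lt; rewrite -/g; nra.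
exists eps => // n S Sh; apply: heps; apply: le_trans Sh _.
rewrite ler_expR ler_wpM2l // a00 entropy0 entropy_ge0 //; lra.
Qed.

(** * Smoothing by neighbours *)

Definition flip n (j : 'I_n) (x : cube n) : cube n := x + delta_mx ord0 j.

Lemma flipE n (j i : 'I_n) (x : cube n) :
  flip j x ord0 i = if i == j then x ord0 i + 1 else x ord0 i.
Proof. by rewrite !mxE eqxx /= eq_sym; case: eqP => _ //; rewrite addr0. Qed.

Lemma flipK n (j : 'I_n) : involutive (flip j).
Proof.
move=> x; apply/rowP => i; rewrite flipE; case: eqP => [ij|ij]; rewrite flipE.
  rewrite ij eqxx -addrA -[RHS]addr0; congr (_ + _); exact/val_inj.
by move/eqP/negbTE: ij => ->.
Qed.

Lemma F2_add1_eq0 (a : 'F_2) : (a + 1 == 0) = (a != 0).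
Proof. by case: (F2_cases a) => ->. Qed.

Lemma weightE n (x : cube n) : weight x = (\sum_j (x ord0 j != 0%R))%N.
Proof. by rewrite /weight -sum1_card big_mkcond. Qed.

Lemma weight_flip n (j : 'I_n) (x : cube n) :
  x ord0 j = 0 -> weight (flip j x) = (weight x).+1.
Proof.
move=> xj; rewrite !weightE (bigD1 j) //= [in RHS](bigD1 j) //= flipE eqxx xj.
rewrite add0r oner_eq0 eqxx add1n add0n; congr _.+1.
by apply: eq_bigr => i /negbTE ij; rewrite flipE ij.
Qed.

Lemma weight_le_flip n (j : 'I_n) (x : cube n) :
  (weight x <= (weight (flip j x)).+1)%N.
Proof.
have [xj|xj] := eqVneq (x ord0 j) 0; first by rewrite weight_flip //; lia.
rewrite -{1}(flipK j x) weight_flip // flipE eqxx.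
by apply/eqP; rewrite F2_add1_eq0.
Qed.

Lemma weight_leq n (x : cube n) : (weight x <= n)%N.
Proof. by rewrite /weight (leq_trans (max_card _)) // card_ord. Qed.

Lemma sum_eq0_weight n (x : cube n) : (\sum_j (x ord0 j == 0%R))%N = (n - weight x)%N.
Proof.
apply/eqP; rewrite -(eqn_add2r (weight x)) subnK ?weight_leq // weightE -big_split /=.
by rewrite (eq_bigr (fun=> 1%N)) ?sum1_card ?card_ord // => j _; case: eqP.
Qed.

Lemma pairing_flip n (j : 'I_n) (w x : cube n) :
  pairing w (flip j x) = pairing w x + w ord0 j.
Proof.
rewrite /pairing (bigD1 j) //= [in RHS](bigD1 j) //= flipE eqxx mulrDr mulr1.
rewrite [RHS]addrAC; congr (_ + _).
by apply: eq_bigr => i /negbTE ij; rewrite flipE ij.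
Qed.

Section Smoothing.
Variables (R : realType) (n : nat).
Implicit Types f g : cfun R n.

(** [n] times the identity plus the adjacency matrix of the cube. Adding the
    identity makes all eigenvalues nonnegative, so that the characters of
    weight close to [n] are not amplified. *)
Definition smooth f : cfun R n := [ffun x => \sum_j (f x + f (flip j x))].

Definition multiplier (w : cube n) : R := 2 * (n - weight w)%:R.

Lemma sum_flip (V : nmodType) (j : 'I_n) (F : cube n -> V) :
  \sum_x F (flip j x) = \sum_x F x.
Proof. by rewrite [RHS](reindex_inj (inv_inj (flipK j))). Qed.

Lemma fourier_smooth f w : fourier (smooth f) w = (multiplier w)%:C * fourier f w.
Proof.
rewrite [LHS]ffunE.
under eq_bigr do rewrite ffunE mulr_sumr.
rewrite exchange_big /=.
transitivity (\sum_(j < n) (1 + sign2 R[i] (w ord0 j)) * fourier f w).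
  apply: eq_bigr => j _.
  under eq_bigr do rewrite mulrDr.
  rewrite big_split mulrDl mul1r /=; congr (_ + _); first by rewrite [RHS]ffunE.
  rewrite -(sum_flip j) /= [in RHS]ffunE mulr_sumr; apply: eq_bigr => x _.
  rewrite flipK pairing_flip mulrA; congr (_ * _).
  by rewrite addrC; exact: sign2D.
rewrite -mulr_suml; congr (_ * _).
rewrite /multiplier -sum_eq0_weight natr_sum mulr_sumr rmorph_sum /=.
apply: eq_bigr => j _; case: (F2_cases (w ord0 j)) => ->.
  by rewrite eqxx /sign2 mulr1 rmorph_nat.
by rewrite oner_eq0 /sign2 /= expr1 mulr0 subrr.
Qed.

Lemma smooth_support f (r : nat) :
  (forall x, (r < weight x)%N -> f x = 0) ->
  forall x, (r.+1 < weight x)%N -> smooth f x = 0.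
Proof.
move=> fr x xr; rewrite ffunE big1 // => j _.
rewrite !fr ?addr0 //; last by lia.
by have := weight_le_flip j x; lia.
Qed.

Lemma fourier_iter_smooth k f w :
  fourier (iter k smooth f) w = (multiplier w ^+ k)%:C * fourier f w.
Proof.
elim: k => [|k IH]; first by rewrite expr0 mul1r.
by rewrite iterS fourier_smooth IH mulrA -rmorphM -exprS.
Qed.

Lemma iter_smooth_support k f (r : nat) :
  (forall x, (r < weight x)%N -> f x = 0) ->
  forall x, (r + k < weight x)%N -> iter k smooth f x = 0.
Proof.
move=> fr; elim: k => [|k IH]; first by move=> x; rewrite addn0; exact: fr.
by rewrite addnS; exact: smooth_support.
Qed.

End Smoothing.

(** Jensen's inequality for the [k]-th power. Each step is a correlation
    inequality: [X ^+ j - mu ^+ j] and [X - mu] have the same sign. *)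
Lemma moment_ge (R : realDomainType) (I : finType) (p X : I -> R) (mu : R) (k : nat) :
  (forall i, 0 <= p i) -> (forall i, 0 <= X i) -> 0 <= mu ->
  mu * \sum_i p i <= \sum_i X i * p i ->
  mu ^+ k * \sum_i p i <= \sum_i X i ^+ k * p i.
Proof.
move=> p0 X0 mu0 h.
have step j : mu * \sum_i X i ^+ j * p i <= \sum_i X i ^+ j.+1 * p i.
  have h1 : 0 <= mu ^+ j * (\sum_i X i * p i - mu * \sum_i p i).
    by rewrite mulr_ge0 ?exprn_ge0 // subr_ge0.
  rewrite -subr_ge0; apply: le_trans h1 _.
  rewrite mulr_sumr [mu * \sum_i _]mulr_sumr -!sumrB mulr_sumr.
  apply: ler_sum => i _; rewrite -subr_ge0.
  have -> : X i ^+ j.+1 * p i - mu * (X i ^+ j * p i)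
      - mu ^+ j * (X i * p i - mu * p i) =
    p i * ((X i ^+ j - mu ^+ j) * (X i - mu)) by rewrite exprS; ring.
  rewrite mulr_ge0 //; have [Xm|mX] := leP (X i) mu.
    by rewrite mulr_le0 // subr_le0 // lerXn2r ?nnegrE.
  by rewrite mulr_ge0 // subr_ge0 ?lerXn2r ?nnegrE // ltW.
elim: k => [|k IH]; first by
  rewrite expr0 mul1r; under [leRHS]eq_bigr do rewrite expr0 mul1r.
by rewrite exprS -mulrA; apply: le_trans (step k); rewrite ler_wpM2l.
Qed.

(** * A test function on consecutive levels *)

Definition level n (w : nat) : {set cube n} := [set x : cube n | weight x == w]%SET.

Lemma card_level n w : #|level n w| = (\sum_(x : cube n) (weight x == w))%N.
Proof.
by rewrite -sum1_card big_mkcond /=; apply: eq_bigr => x _; rewrite inE; case: eqP.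
Qed.

(** Both sides count the edges between the two levels. *)
Lemma card_levelS n w : (w.+1 * #|level n w.+1| = (n - w) * #|level n w|)%N.
Proof.
transitivity (\sum_(j < n) \sum_(x : cube n) (x ord0 j != 0%R) * (weight x == w.+1))%N.
  rewrite exchange_big card_level big_distrr /=; apply: eq_bigr => x _.
  rewrite -big_distrl /= -weightE.
  by case: eqP => [->|_]; rewrite ?muln1 ?muln0.
transitivity (\sum_(j < n) \sum_(x : cube n) (x ord0 j == 0%R) * (weight x == w))%N; last first.
  rewrite exchange_big card_level big_distrr /=; apply: eq_bigr => x _.
  rewrite -big_distrl /= sum_eq0_weight.
  by case: eqP => [->|_]; rewrite ?muln1 ?muln0.
apply: eq_bigr => j _; rewrite (reindex_inj (inv_inj (flipK j))) /=.
apply: eq_bigr => x _; rewrite flipE eqxx F2_add1_eq0 negbK.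
by case: eqP => [xj|_] //; rewrite weight_flip // eqSS.
Qed.

Lemma card_level_gt0 n w : (w <= n)%N -> (0 < #|level n w|)%N.
Proof.
elim: w => [_|w IH wn].
  apply/card_gt0P; exists 0; rewrite inE weightE big1 // => j _.
  by rewrite mxE eqxx.
have := IH (ltnW wn); rewrite -(ltn_pmul2l (m := (n - w)%N)) ?muln0 ?subn_gt0 //.
by rewrite -card_levelS muln_gt0.
Qed.

Section TestFunction.
Variables (R : realType) (n a m : nat).
Hypothesis amn : (a + m <= n)%N.

Let N w : R := #|level n w|%:R.

(** Sums of radial functions reduce to sums over the levels of the window. *)
Lemma sum_radial (F : nat -> R) :
  (forall w, ~~ (a <= w <= a + m)%N -> F w = 0) ->
  \sum_(x : cube n) F (weight x) = \sum_(i < m.+1) N (a + i) * F (a + i)%N.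
Proof.
move=> F0.
transitivity (\sum_(x : cube n) \sum_(i < m.+1)
  (weight x == (a + i)%N)%:R * F (a + i)%N).
  apply: eq_bigr => x _.
  have [xw|xw] := boolP (a <= weight x <= a + m)%N; last first.
    rewrite F0 // big1 // => i _; case: eqP => [xi|]; last by rewrite /= mulr0n mul0r.
    by rewrite F0 ?mulr0 //; case: i xi => i /= ? ?; lia.
  rewrite (bigD1 (inord (weight x - a))) //= inordK; last by lia.
  rewrite subnKC; last by lia.
  rewrite eqxx /= mulr1n mul1r big1 ?addr0 // => i.
  rewrite -val_eqE /= inordK; last by lia.
  by move=> iw; case: eqP => [xi|_]; [lia|rewrite /= mulr0n mul0r].
rewrite exchange_big /=; apply: eq_bigr => i _.
by rewrite -mulr_suml /N card_level natr_sum.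
Qed.

(** Radial profile giving the same mass 1 to each of the [m.+1] levels. *)
Definition window w : R :=
  if (a <= w <= a + m)%N then (Num.sqrt (N w))^-1 else 0.

Definition test : cfun R n := [ffun x => (window (weight x))%:C].

Lemma test_support x : (a + m < weight x)%N -> test x = 0.
Proof. by move=> h; rewrite ffunE /window ifF //; lia. Qed.

Lemma window_ge0 w : 0 <= window w.
Proof. by rewrite /window; case: ifP => // _; rewrite invr_ge0 sqrtr_ge0. Qed.

Lemma N_gt0 w : (w <= n)%N -> 0 < N w.
Proof. by move=> wn; rewrite ltr0n card_level_gt0. Qed.

Lemma energy_test : energy test = m.+1%:R.
Proof.
rewrite /energy.
under eq_bigr do rewrite ffunE cabs_real ger0_norm ?window_ge0 //.
rewrite (sum_radial (F := fun w => window w ^+ 2)) => [|w /negbTE h]; last first.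
  by rewrite /window h expr0n.
rewrite -[m.+1 in RHS]card_ord -sum1_card natr_sum; apply: eq_bigr => i _.
rewrite /window ifT; last by case: i => i /= ?; lia.
have Nn : 0 < N (a + i) by apply: N_gt0; case: i => i /= ?; lia.
by rewrite exprVn sqr_sqrtr ?ltW // divff // gt_eqF.
Qed.

(** The edges between levels [w] and [w.+1], weighted by the profile, add up to
    the geometric mean of [n - w] and [w.+1]. *)
Lemma level_flow_ge (tau : R) (w : nat) :
  (a <= w < a + m)%N -> 0 <= tau ->
  tau ^+ 2 <= (n - w)%:R * w.+1%:R ->
  tau <= N w * ((n - w)%:R * (window w * window w.+1)).
Proof.
move=> aw tau0 h.
have Nw : 0 < N w by apply: N_gt0; lia.
have Nw1 : 0 < N w.+1 by apply: N_gt0; lia.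
rewrite /window !ifT; [|lia|lia].
have NE : w.+1%:R * N w.+1 = (n - w)%:R * N w :> R.
  by rewrite /N -!natrM card_levelS.
rewrite -ler_sqr ?nnegrE //; last first.
  by rewrite !mulr_ge0 // ?invr_ge0 ?sqrtr_ge0 ?ltW.
apply: le_trans h _.
rewrite !exprMn !exprVn !sqr_sqrtr ?(ltW Nw) ?(ltW Nw1) //.
have -> : w.+1%:R = (n - w)%:R * N w / N w.+1 by rewrite -NE mulfK // gt_eqF.
rewrite le_eqVlt; apply/orP; left; apply/eqP.
by field; rewrite !gt_eqF.
Qed.

(** Every edge is seen from both of its ends, whence the factor 2; the [m.+1]
    levels are joined by [m] layers of edges. *)
Lemma flip_form_ge (tau : R) : 0 <= tau ->
  (forall w, (a <= w < a + m)%N -> tau ^+ 2 <= (n - w)%:R * w.+1%:R) ->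
  2 * (m%:R * tau)
  <= \sum_(x : cube n) \sum_j window (weight x) * window (weight (flip j x)).
Proof.
move=> tau0 h.
have halfE (j : 'I_n) :
    \sum_(x : cube n) window (weight x) * window (weight (flip j x)) =
    2 * \sum_(x : cube n) (x ord0 j == 0)%:R *
      (window (weight x) * window (weight x).+1).
  rewrite (bigID (fun x : cube n => x ord0 j == 0)) /=.
  have -> : \sum_(x : cube n | x ord0 j != 0)
      window (weight x) * window (weight (flip j x))
     = \sum_(x : cube n | x ord0 j == 0)
      window (weight x) * window (weight (flip j x)).
    rewrite (reindex_inj (inv_inj (flipK j))) /=; apply: eq_big => x.
      by rewrite flipE eqxx F2_add1_eq0 negbK.
    by rewrite flipK mulrC.
  rewrite -mulr2n mulr_natl; congr (_ *+ 2); rewrite [LHS]big_mkcond /=.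
  apply: eq_bigr => x _; case: eqP => [xj|_]; last by rewrite /= mulr0n mul0r.
  by rewrite /= mulr1n mul1r weight_flip.
rewrite exchange_big (eq_bigr _ (fun j _ => halfE j)) -mulr_sumr ler_pM2l //.
rewrite exchange_big /=.
under eq_bigr do rewrite -mulr_suml -natr_sum sum_eq0_weight.
rewrite (sum_radial (F := fun w => (n - w)%:R * (window w * window w.+1)))
  => [|w /negbTE aw]; last first.
  by rewrite {1}/window aw mul0r mulr0.
rewrite big_ord_recr /= -[leLHS]addr0 lerD //; last first.
  by rewrite !mulr_ge0 ?window_ge0.
rewrite -[m in leLHS]card_ord mulr_natl -sumr_const; apply: ler_sum => i _.
have ai : (a <= a + i < a + m)%N by case: i => i /= ?; lia.
by apply: level_flow_ge => //; exact: h.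
Qed.

Lemma rayleigh_test (tau : R) : 0 <= tau ->
  (forall w, (a <= w < a + m)%N -> tau ^+ 2 <= (n - w)%:R * w.+1%:R) ->
  2 ^+ n * (n%:R * m.+1%:R + 2 * (m%:R * tau))
  <= \sum_w multiplier R w * cabs (fourier test w) ^+ 2.
Proof.
move=> tau0 h.
have -> : \sum_w multiplier R w * cabs (fourier test w) ^+ 2 =
   2 ^+ n * \sum_(x : cube n) \sum_j
     (window (weight x) ^+ 2 + window (weight x) * window (weight (flip j x))).
  apply: complexI; rewrite rmorphM /= -pow2C.
  rewrite [RHS](_ : _ = 2 ^+ n * \sum_x smooth test x * conjc (test x)).
    rewrite -parseval rmorph_sum /=; apply: eq_bigr => w _.
    by rewrite fourier_smooth -mulrA mul_conj -rmorphM.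
  congr (_ * _); rewrite rmorph_sum /=; apply: eq_bigr => x _.
  rewrite [smooth test x]ffunE mulr_suml rmorph_sum /=; apply: eq_bigr => j _.
  rewrite !ffunE conjc_real -rmorphD -rmorphM /=; congr (_%:C); ring.
rewrite ler_wpM2l ?exprn_ge0 //.
under eq_bigr do rewrite big_split /= sumr_const card_ord -mulr_natl.
rewrite big_split /= -mulr_sumr lerD ?flip_form_ge // ler_wpM2l //.
rewrite -energy_test /energy le_eqVlt; apply/orP; left; apply/eqP.
by apply: eq_bigr => x _; rewrite ffunE cabs_real ger0_norm ?window_ge0.
Qed.

End TestFunction.

(** * Functions concentrated on both balls *)

Lemma energy_fourier_iter_smooth (R : realType) (n k : nat)
    (f : cfun R n) (w : cube n) :
  cabs (fourier (iter k (@smooth R n) f) w) ^+ 2 =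
  multiplier R w ^+ (k + k) * cabs (fourier f w) ^+ 2.
Proof.
rewrite fourier_iter_smooth cabsM cabs_real ger0_norm; last first.
  by rewrite exprn_ge0 // mulr_ge0.
by rewrite exprMn -exprM muln2 addnn.
Qed.

Lemma energy_iter_smooth_ge (R : realType) (n k : nat) (f : cfun R n) (mu : R) :
  0 <= mu ->
  mu * (2 ^+ n * energy f)
    <= \sum_w multiplier R w * cabs (fourier f w) ^+ 2 ->
  mu ^+ (k + k) * (2 ^+ n * energy f) <= 2 ^+ n * energy (iter k (@smooth R n) f).
Proof.
move=> mu0; rewrite -!energy_fourier => h.
rewrite [leRHS](eq_bigr _ (fun w _ => energy_fourier_iter_smooth k f w)).
apply: moment_ge => // w; first exact: sqr_ge0.
by rewrite mulr_ge0.
Qed.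

(** Above weight [r] the multiplier is at most [2 * (n%:R - r)], whereas its
    mean with respect to the spectral distribution of [f] is at least [mu]. *)
Lemma leakage_iter_smooth (R : realType) (n k : nat) (f : cfun R n) (mu r : R) :
  0 <= mu -> r <= n%:R ->
  mu * (2 ^+ n * energy f)
    <= \sum_w multiplier R w * cabs (fourier f w) ^+ 2 ->
  mu ^+ (k + k) * spectral_mass (~: hball n r)%SET (iter k (@smooth R n) f)
  <= (2 * (n%:R - r)) ^+ (k + k) * (2 ^+ n * energy (iter k (@smooth R n) f)).
Proof.
move=> mu0 rn h.
have r0 : 0 <= 2 * (n%:R - r) by lra.
have low : spectral_mass (~: hball n r)%SET (iter k (@smooth R n) f)
    <= (2 * (n%:R - r)) ^+ (k + k) * (2 ^+ n * energy f).
  rewrite -energy_fourier /energy mulr_sumr /spectral_mass big_mkcond /=.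
  apply: ler_sum => w _; case: ifP => [|_]; last by rewrite mulr_ge0 ?sqr_ge0 ?exprn_ge0.
  rewrite !inE -ltNge => wr; rewrite energy_fourier_iter_smooth ler_wpM2r ?sqr_ge0 //.
  rewrite lerXn2r ?nnegrE // ?mulr_ge0 //.
  by rewrite ler_pM2l // natrB ?weight_leq // lerD2l lerN2 ltW.
apply: le_trans (ler_wpM2l (exprn_ge0 _ mu0) low) _.
rewrite mulrCA ler_wpM2l ?exprn_ge0 //.
exact: energy_iter_smooth_ge.
Qed.

(** [mu] is the lower bound for the Rayleigh quotient of the test function on
    the levels [a], ..., [a + m]; the first witness is the [k]-fold smoothing
    of this function. *)
Lemma cos_angle_ball_ge (R : realType) (n a m k : nat) (r1 r2 tau mu d : R) :
  (a + m <= n)%N -> (a + m + k)%:R <= r1 -> r2 <= n%:R -> 0 <= tau ->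
  (forall w, (a <= w < a + m)%N -> tau ^+ 2 <= (n - w)%:R * w.+1%:R) ->
  0 < mu -> mu * m.+1%:R = n%:R * m.+1%:R + 2 * (m%:R * tau) ->
  (2 * (n%:R - r2) / mu) ^+ (k + k) <= d -> d < 1 ->
  1 - d <= cos_angle (V_time R (hball n r1)) (V_freq R (hball n r2)).
Proof.
move=> amn amk r2n tau0 tau_le mu0 muE hd d1.
pose f := test R n a m.
pose g := iter k (@smooth R n) f.
have ef : energy f = m.+1%:R by exact: energy_test.
have rq : mu * (2 ^+ n * energy f)
    <= \sum_w multiplier R w * cabs (fourier f w) ^+ 2.
  by rewrite mulrCA ef muE; exact: rayleigh_test.
have E0 : 0 < 2 ^+ n * energy g.
  apply: lt_le_trans (energy_iter_smooth_ge k (ltW mu0) rq).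
  by rewrite !mulr_gt0 ?exprn_gt0 // ef.
have g0 : g != 0.
  by rewrite -energy_eq0 gt_eqF // -(@pmulr_rgt0 _ (2 ^+ n)) ?exprn_gt0.
have gS : V_time R (hball n r1) g.
  apply/supportP => x; rewrite inE -ltNge => xr.
  apply: (@iter_smooth_support R n k f (a + m)).
    by move=> y; exact: test_support.
  by rewrite -(ltr_nat R); apply: le_lt_trans xr.
apply: (cos_angle_ge gS g0 d1).
apply: le_trans (ler_wpM2r (ltW E0) hd).
rewrite expr_div_n mulrAC ler_pdivlMr ?exprn_gt0 // mulrC.
exact: leakage_iter_smooth (ltW mu0) r2n rq.
Qed.

(** The number of levels is fixed so that the loss [th = m / m.+1] in the
    Rayleigh quotient keeps [th ^+ 2 * (2 * s)] above [1 - 2 * rho2]. The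
    window starts at [th ^+ 2 * rho1 * n], and the remaining room
    [2 * d * n] below [rho1 * n] is shared between the window and the [k]
    smoothing steps. *)
Lemma concentration (R : realType) (rho1 rho2 : R) :
  0 <= rho1 <= 1 / 2 -> 0 <= rho2 <= 1 / 2 ->
  (1 - 2 * rho1) ^+ 2 + (1 - 2 * rho2) ^+ 2 < 1 ->
  exists (eps : R) (n0 : nat), 0 < eps /\
    forall n : nat, (n0 <= n)%N ->
      1 - expR (- (n%:R * eps)) <=
        cos_angle (V_time R (hball n (rho1 * n%:R)))
                  (V_freq R (hball n (rho2 * n%:R))).
Proof.
move=> /andP[a0 a1] /andP[b0 b1] h.
have p0 : 0 <= rho1 * (1 - rho1) by rewrite mulr_ge0 //; lra.
set s := Num.sqrt (rho1 * (1 - rho1)).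
have s0 : 0 <= s := sqrtr_ge0 _.
have s2 : s ^+ 2 = rho1 * (1 - rho1) by rewrite sqr_sqrtr.
have gap0 : 1 - 2 * rho2 < 2 * s.
  by rewrite -ltr_sqr ?nnegrE ?mulr_ge0 //; [rewrite exprMn s2; lra|lra].
have s1 : 2 * s <= 1 by rewrite -ler_sqr ?nnegrE ?mulr_ge0 // exprMn s2; nra.
have rho1_gt0 : 0 < rho1.
  rewrite lt_neqAle a0 andbT; apply/eqP => e.
  have : 0 < s ^+ 2 by rewrite exprn_gt0 //; lra.
  by rewrite s2 -e mul0r ltxx.
pose gap := 2 * s - (1 - 2 * rho2).
have gap_gt0 : 0 < gap by rewrite /gap; lra.
pose m := Num.truncn (2 / gap).
pose M : R := m.+1%:R.
have M0 : 0 < M by rewrite ltr0n.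
have mM : 2 < gap * M.
  have := truncnS_gt (2 / gap); rewrite -/m -/M ltr_pdivrMr // mulrC; exact.
pose i := M^-1.
have iM : i * M = 1 by rewrite mulVf // gt_eqF.
have i0 : 0 < i by rewrite invr_gt0.
have i1 : i <= 1 by rewrite invf_le1 // ler1n.
have igap : 2 * i < gap by rewrite ltr_pdivrMr.
pose th : R := 1 - i.
have thM : m%:R = th * M by rewrite mulrBl iM mul1r /M -natr1; ring.
clearbody i.
have th0 : 0 <= th by rewrite subr_ge0.
have th1 : th ^+ 2 < 1 by rewrite expr_lt1 // /th; lra.
have th_gap : 1 - 2 * rho2 < th ^+ 2 * (2 * s).
  have : 0 <= i ^+ 2 * (2 * s) by rewrite mulr_ge0 ?sqr_ge0 // mulr_ge0.
  have : i * (2 * s) <= i by rewrite ler_piMr // ltW.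
  by rewrite /th; rewrite /gap in igap; lra.
pose d := (1 - th ^+ 2) * rho1 / 2.
have d0 : 0 < d by rewrite divr_gt0 // mulr_gt0 // subr_gt0.
(* [n%:R * X] will bound the Rayleigh quotient from below, so the high
   frequencies keep at most the fraction [(1 - kap) ^+ (k + k)] of the energy
   after [k] smoothing steps. *)
pose X := 1 + th ^+ 2 * (2 * s).
have X0 : 0 < X by rewrite /X; lra.
pose kap := 1 - 2 * (1 - rho2) / X.
have kap0 : 0 < kap by rewrite subr_gt0 ltr_pdivrMr // mul1r /X; lra.
exists (d * kap), (Num.truncn (m.+2%:R / d)).+1; split; first by rewrite mulr_gt0.
move=> n nbig.
have dn : m.+2%:R < d * n%:R.
  have := truncnS_gt (m.+2%:R / d); rewrite ltr_pdivrMr // => /lt_le_trans; apply.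
  by rewrite mulrC ler_pM2l // ler_nat.
have n0 : 0 < n%:R :> R by rewrite ltr0n (leq_trans _ nbig).
pose k := Num.truncn (d * n%:R).
have dn0 : 0 <= d * n%:R by rewrite mulr_ge0 // ltW.
have k_le : k%:R <= d * n%:R by rewrite truncn_le.
have k_gt : d * n%:R < k.+1%:R by exact: truncnS_gt.
pose a := Num.truncn (th ^+ 2 * rho1 * n%:R).
have tn0 : 0 <= th ^+ 2 * rho1 * n%:R by rewrite !mulr_ge0 ?sqr_ge0.
have a_le : a%:R <= th ^+ 2 * rho1 * n%:R by rewrite truncn_le.
have a_gt : th ^+ 2 * rho1 * n%:R < a.+1%:R by exact: truncnS_gt.
have amk : (a + m + k)%:R <= rho1 * n%:R.
  have : m%:R + 2 < d * n%:R by move: dn; rewrite -addn2 natrD.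
  rewrite !natrD /d in k_le *; lra.
have amk_n : (a + m + k <= n)%N.
  by rewrite -(ler_nat R); apply: le_trans amk _; rewrite ler_piMl ?ltW //; lra.
have amn : (a + m <= n)%N := leq_trans (leq_addr _ _) amk_n.
pose tau := th * s * n%:R.
have tau0 : 0 <= tau by rewrite !mulr_ge0.
have tau_le w : (a <= w < a + m)%N -> tau ^+ 2 <= (n - w)%:R * w.+1%:R.
  move=> /andP[aw wam].
  have wn : (w <= n)%N := leq_trans (ltnW wam) amn.
  rewrite /tau !exprMn s2 natrB //.
  have w1 : w%:R <= rho1 * n%:R.
    by apply: le_trans amk; rewrite ler_nat (leq_trans (ltnW wam)) // leq_addr.
  have w2 : th ^+ 2 * rho1 * n%:R <= w.+1%:R.
    by apply: le_trans (ltW a_gt) _; rewrite ler_nat ltnS.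
  have -> : th ^+ 2 * (rho1 * (1 - rho1)) * n%:R ^+ 2 =
     (n%:R - rho1 * n%:R) * (th ^+ 2 * rho1 * n%:R) by ring.
  apply: ler_pM => //; last by rewrite lerD2l lerN2.
  by rewrite -{1}[n%:R]mul1r -mulrBl mulr_ge0 //; lra.
pose mu := n%:R * X.
have mu0 : 0 < mu := mulr_gt0 n0 X0.
have rn : rho2 * n%:R <= n%:R by rewrite ler_piMl ?(ltW n0) //; lra.
apply: (@cos_angle_ball_ge _ n a m k _ _ tau mu) => //.
- by rewrite /mu /X /tau thM -/M; ring.
- have -> : 2 * (n%:R - rho2 * n%:R) / mu = 1 - kap.
    by rewrite /mu /kap; field; rewrite !gt_eqF.
  have kap1 : 0 <= 1 - kap by rewrite subKr divr_ge0 ?(ltW X0) //; lra.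
  apply: le_trans (_ : expR (- kap) ^+ (k + k) <= _).
    by rewrite lerXn2r ?nnegrE ?expR_ge0 // expR_ge1Dx.
  rewrite -expRM_natl ler_expR mulrN lerN2 mulrA ler_wpM2r ?(ltW kap0) //.
  have : 2 < d * n%:R by apply: le_lt_trans dn; rewrite ler_nat.
  by rewrite natrD; rewrite -natr1 in k_gt; lra.
- rewrite -[ltRHS]expR0 ltr_expR oppr_lt0.
  exact: mulr_gt0 n0 (mulr_gt0 d0 kap0).
Qed.

Theorem theorem9 (R : realType) :
  (forall rho1 rho2 : R,
     0 <= rho1 <= 1 / 2 -> 0 <= rho2 <= 1 / 2 ->
     (1 - 2 * rho1) ^+ 2 + (1 - 2 * rho2) ^+ 2 > 1 ->
     exists (eps : R) (n0 : nat), 0 < eps /\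
       forall n : nat, (n0 <= n)%N ->
       forall S : {set cube n},
         #|S|%:R <= expR (n%:R * entropy rho1) ->
         cos_angle (V_time R S) (V_freq R (hball n (rho2 * n%:R)))
           <= expR (- (n%:R * eps)))
  /\
  (forall rho1 rho2 : R,
     0 <= rho1 <= 1 / 2 -> 0 <= rho2 <= 1 / 2 ->
     (1 - 2 * rho1) ^+ 2 + (1 - 2 * rho2) ^+ 2 < 1 ->
     exists (eps : R) (n0 : nat), 0 < eps /\
       forall n : nat, (n0 <= n)%N ->
         1 - expR (- (n%:R * eps)) <=
           cos_angle (V_time R (hball n (rho1 * n%:R)))
                     (V_freq R (hball n (rho2 * n%:R)))).
Proof.
split=> [rho1 rho2 h1 h2 h|]; last exact: concentration.
have [eps eps0 heps] := uncertainty h1 h2 h.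
by exists eps, 0%N; split=> // n _; exact: heps.
Qed.
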